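(* Let $k,n,i$ be positive integers with $1\le i\le n\le k-1$. Then \[ \sum_{\substack{k_1+k_2+\cdots+k_n=k\\ k_1,\ldots,k_n\ge 1,\ k_i\ge 2}}\zeta^{*}_{\mathcal F}(k_1,k_2,\ldots,k_n)\equiv(-1)^{i-1}\left(\binom{k-1}{i-1}+(-1)^n\binom{k-1}{n-i}\right)\zeta(k)\pmod{\zeta(2)}, \] where the congruence means that the difference of the two sides lies in the ideal $\zeta(2)\mathcal Z$ of the $\mathbb Q$-algebra $\mathcal Z$.
   Context: For positive integers $k_1,\ldots,k_n$ with $k_1\ge 2$, $\zeta(k_1,\ldots,k_n)=\sum_{m_1>m_2>\cdots>m_n\ge 1} m_1^{-k_1}\cdots m_n^{-k_n}$; $\zeta(k)$ is the Riemann zeta value. $\mathcal Z$ is the $\mathbb Q$-subspace of $\mathbb R$ spanned by all multiple zeta values (a $\mathbb Q$-algebra). For arbitrary positive integers $k_1,\dots,k_n$, $\zeta^{*}(k_1,\ldots,k_n)\in\mathcal Z$ denotes the harmonic-regularized multiple zeta value in the sense of Ihara–Kaneko–Zagier (constant term of the harmonic regularization polynomial in $T$, i.e. the unique extension of the convergent values compatible with the harmonic (stuffle) product and with $\zeta^*(1)=T$, evaluated at $T=0$), with $\zeta^*(\emptyset)=1$. Define \[\zeta^{*}_{\mathcal F}(k_1,\ldots,k_n)=\sum_{i=0}^{n}(-1)^{k_1+\cdots+k_i}\zeta^{*}(k_i,k_{i-1},\ldots,k_1)\,\zeta^{*}(k_{i+1},\ldots,k_n).\] *)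

(* Defs.v *)
From mathcomp Require Import all_boot all_order all_algebra.
From mathcomp Require Import all_classical all_reals all_analysis.

Set Implicit Arguments.
Unset Strict Implicit.
Unset Printing Implicit Defensive.

Import Order.TTheory GRing.Theory Num.Theory.
Import numFieldNormedType.Exports.

Local Open Scope classical_set_scope.
Local Open Scope ring_scope.

(* An index (k_1, ..., k_n) of positive integers is a [seq nat]. *)
Definition positive_index (s : seq nat) : bool := all (leq 1) s.

(* The empty index is admissible. *)
Definition admissible (s : seq nat) : bool :=
  positive_index s && (2 <= head 2 s)%N.

(* The sum of m_1^-k_1 ... m_n^-k_n over N > m_1 > ... > m_n >= 1. *)
Fixpoint mzv_trunc (R : realType) (s : seq nat) (N : nat) : R :=
  if s is k :: s' then \sum_(1 <= m < N) m%:R ^- k * mzv_trunc R s' m else 1.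

(* Meaningful for admissible [s]; otherwise the partial sums diverge. *)
Definition mzv (R : realType) (s : seq nat) : R :=
  limn (fun N : nat => mzv_trunc R s N).

(* The Q-span of the multiple zeta values; it contains 1 = mzv [::]. *)
Definition mzv_space (R : realType) : set R :=
  [set x | exists2 c : seq (rat * seq nat),
     all (fun p => admissible p.2) c &
     x = \sum_(p <- c) ratr p.1 * mzv R p.2].

Definition zeta2_ideal (R : realType) : set R :=
  [set mzv R [:: 2%N] * y | y in @mzv_space R].

(* The harmonic product of the words z_{s_1} z_{s_2} ... and
   z_{t_1} z_{t_2} ..., as the list with multiplicities of its terms:
   z_a u * z_b v = z_a (u * z_b v) + z_b (z_a u * v) + z_{a+b} (u * v). *)
Fixpoint stuffle (s : seq nat) : seq nat -> seq (seq nat) :=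
  if s is a :: s' then
    fix stuffle_s (t : seq nat) : seq (seq nat) :=
      if t is b :: t' then
        [seq a :: w | w <- stuffle s' t] ++
        [seq b :: w | w <- stuffle_s t'] ++
        [seq (a + b)%N :: w | w <- stuffle s' t']
      else [:: s]
  else fun t => [:: t].

(* [Z] is given on words; its Q-linear extension is a homomorphism for the
   harmonic product to polynomials in T = 'X. *)
Definition is_harmonic_reg (R : realType) (Z : seq nat -> {poly R}) : Prop :=
  [/\ Z [:: 1%N] = 'X,
      forall s, admissible s -> Z s = (mzv R s)%:P
    & forall s t, positive_index s -> positive_index t ->
        Z s * Z t = \sum_(w <- stuffle s t) Z w].

(* Such a map exists and its values on positive indices are unique
   (Ihara-Kaneko-Zagier); its values on other sequences are irrelevant. *)
Definition harmonic_reg (R : realType) : seq nat -> {poly R} :=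
  xget (fun=> 0) [set Z | @is_harmonic_reg R Z].

Definition zeta_star (R : realType) (s : seq nat) : R :=
  (harmonic_reg R s).[0].

Definition zeta_star_F (R : realType) (s : seq nat) : R :=
  \sum_(0 <= j < (size s).+1)
    (-1) ^+ sumn (take j s) *
    zeta_star R (rev (take j s)) * zeta_star R (drop j s).

(* A part of a composition of k is at most k, so 'I_k.+1 loses no index. *)
Definition index_of (k n : nat) (t : n.-tuple 'I_k.+1) : seq nat :=
  [seq nat_of_ord j | j <- t].

(* Main.v *)
(* Write I for the ideal generated by zeta(2).  Coproduct compatibility of the
   harmonic product with a single letter gives
     zF ([a] * w) = (1 + (-1)^a) zeta*(a) zF w,
   which lies in I because zeta(2m) does (Euler's convolution formula).  Summing
   over a and over all words w of weight k - a and length n - 1 with a marked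
   entry >= 2 gives, for the sums S(n, i) of the theorem,
     (n - i) S(n, i) + i S(n, i + 1) + (k - n) S(n - 1, i) = 0  modulo I,
   a recursion also satisfied by the right-hand sides.  It reduces the theorem to
   n = k - 1, that is, to zF (1^a, 2, 1^b).
   There one has zeta*(1^a, 2, 1^b) =
     sum_j zeta*(1^(a-j)) (-1)^j sum_m m^-2 h_j(1, ..., 1/m) e_b(1, ..., 1/(m-1)),
   and a telescoping connected sum evaluates the inner series to
   C(j+b+1, j) zeta(j+b+2).  Since the generating series P of the zeta*(1^j)
   satisfies P(x) P(-x) = 1 modulo I, only two terms of zF (1^a, 2, 1^b) survive.
   The regularization itself exists because every truncated sum is, up to an error
   negligible against all powers of the harmonic number H, a polynomial in H. *)

Require Import Defs.
From mathcomp Require Import all_boot all_order all_algebra.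
From mathcomp Require Import all_classical all_reals all_analysis.
From mathcomp Require Import zify ring lra.

Set Implicit Arguments.
Unset Strict Implicit.
Unset Printing Implicit Defensive.

Import Order.TTheory GRing.Theory Num.Theory.
Import numFieldNormedType.Exports.

Local Open Scope classical_set_scope.
Local Open Scope ring_scope.

(** * Stuffles with one letter, deconcatenation, and sums over words of given weight *)

Section Words.
Variable V : nmodType.
Implicit Types (f : seq nat -> V) (g : seq nat -> seq nat -> V).

Lemma sum_stuffle1_cons f a b t :
  \sum_(w <- stuffle [:: a] (b :: t)) f w =
  f (a :: b :: t) + (\sum_(w <- stuffle [:: a] t) f (b :: w) + f ((a + b)%N :: t)).
Proof. by rewrite /= !big_cons big_cat big_map big_seq1. Qed.

(** The stuffle recursion read from the right end: a lands before b, after it, or merges with it. *)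
Lemma sum_stuffle1_rcons f a b t :
  \sum_(w <- stuffle [:: a] (rcons t b)) f w =
  \sum_(w <- stuffle [:: a] t) f (rcons w b) +
  (f (rcons (rcons t b) a) + f (rcons t (a + b)%N)).
Proof.
elim: t f => [|c t IH] f.
  by rewrite /= !big_cons !big_nil !addr0 addrA.
rewrite rcons_cons !sum_stuffle1_cons (IH (fun w => f (c :: w))) !rcons_cons.
by rewrite -!addrA; congr (_ + (_ + _)); rewrite addrA addrC.
Qed.

(** Needed because [zeta_star_F] reverses its prefixes; reversal exchanges the left and right
    recursions. *)
Lemma sum_stuffle1_rev f a w :
  \sum_(v <- stuffle [:: a] w) f (rev v) = \sum_(v <- stuffle [:: a] (rev w)) f v.
Proof.
elim: w f => [|b w IH] f; first by rewrite /= !big_seq1.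
rewrite (sum_stuffle1_cons (fun v => f (rev v))) !rev_cons (sum_stuffle1_rcons f).
rewrite -(IH (fun v => f (rcons v b))) [LHS]addrCA.
by congr (_ + _); apply: eq_bigr => v _; rewrite rev_cons.
Qed.

(** The deconcatenation coproduct paired with g; [zeta_star_F] has this shape. *)
Definition deconc g w : V :=
  \sum_(0 <= j < (size w).+1) g (take j w) (drop j w).

Lemma deconc_nil g : deconc g [::] = g [::] [::].
Proof. by rewrite /deconc big_nat1. Qed.

Lemma deconc_cons g a w :
  deconc g (a :: w) = g [::] (a :: w) + deconc (fun u => g (a :: u)) w.
Proof. by rewrite /deconc big_nat_recl. Qed.

Lemma eq_deconc g1 g2 w : (forall u v, g1 u v = g2 u v) ->
  deconc g1 w = deconc g2 w.
Proof. by move=> e; apply: eq_bigr. Qed.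

Lemma deconcD g1 g2 w :
  deconc (fun u v => g1 u v + g2 u v) w = deconc g1 w + deconc g2 w.
Proof. exact: big_split. Qed.

(** A letter is primitive: at each cut the inserted a belongs to the prefix or to the suffix. *)
Lemma deconc_stuffle1 g a w :
  \sum_(v <- stuffle [:: a] w) deconc g v =
  deconc (fun u v => \sum_(x <- stuffle [:: a] u) g x v +
                     \sum_(y <- stuffle [:: a] v) g u y) w.
Proof.
elim: w g => [|b w IH] g.
  by rewrite /= !big_seq1 deconc_cons !deconc_nil /= !big_seq1 addrC.
rewrite sum_stuffle1_cons !deconc_cons.
under eq_bigr do rewrite deconc_cons.
rewrite big_split /= IH big_seq1.
under [X in _ = _ + X]eq_deconc do rewrite sum_stuffle1_cons.
rewrite !deconcD big_cons big_cat big_map big_seq1 /=. Fail fail.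
set A := deconc _ _; set B := deconc _ _; set C := deconc _ _; set D := deconc _ _.
set X := \sum_(_ <- _) _.
rewrite -!addrA [RHS]addrCA; congr (_ + (_ + _)).
rewrite [LHS]addrCA; congr (_ + _); rewrite [RHS]addrCA; congr (_ + _).
by rewrite [RHS]addrCA; congr (_ + _); rewrite addrCA [C + D]addrC.
Qed.

Lemma eq_in_deconc g1 g2 w : (forall u v, w = u ++ v -> g1 u v = g2 u v) ->
  deconc g1 w = deconc g2 w.
Proof. by move=> e; apply: eq_bigr => j _; apply: e; rewrite cat_take_drop. Qed.

Lemma deconc_nseq_cat g a k w : deconc g (nseq a k ++ w) =
  \sum_(0 <= j < a) g (nseq j k) (nseq (a - j) k ++ w) +
  deconc (fun u => g (nseq a k ++ u)) w.
Proof.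
elim: a g => [|a IH] g; first by rewrite big_geq ?add0r.
rewrite deconc_cons (IH (fun u => g (k :: u))) addrA big_nat_recl //=.
Qed.

Lemma deconc_ones_two g a b :
  deconc g (nseq a 1%N ++ 2%N :: nseq b 1%N) =
  \sum_(0 <= j < a.+1) g (nseq j 1%N) (nseq (a - j) 1%N ++ 2%N :: nseq b 1%N) +
  \sum_(0 <= j < b.+1) g (nseq a 1%N ++ 2%N :: nseq j 1%N) (nseq (b - j) 1%N).
Proof.
rewrite deconc_nseq_cat deconc_cons addrA; congr (_ + _).
  by rewrite big_nat_recr //= subnn cats0.
rewrite -[in LHS](cats0 (nseq b 1%N)) deconc_nseq_cat deconc_nil cats0.
rewrite [RHS]big_nat_recr //= subnn; congr (_ + _).
by apply: eq_bigr => j _; rewrite cats0.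
Qed.

Lemma deconc_nseq g a k :
  deconc g (nseq a k) = \sum_(0 <= j < a.+1) g (nseq j k) (nseq (a - j) k).
Proof.
rewrite -[in LHS](cats0 (nseq a k)) deconc_nseq_cat deconc_nil cats0.
rewrite [RHS]big_nat_recr //= subnn; congr (_ + _).
by apply: eq_bigr => j _; rewrite cats0.
Qed.

(** The lower bounds in L carry the side condition of the theorem: L = 1^a 2 1^b selects the words
    of weight k whose marked entry is at least 2. *)
Fixpoint bsum f (k : nat) (L : seq nat) : V :=
  if L is l :: L' then \sum_(l <= c < k.+1) bsum (fun w => f (c :: w)) (k - c) L'
  else if k == 0%N then f [::] else 0.

Lemma eq_bsum f1 f2 k L : f1 =1 f2 -> bsum f1 k L = bsum f2 k L.
Proof.
elim: L f1 f2 k => [|l L IH] f1 f2 k e /=; first by rewrite e.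
by apply: eq_bigr => c _; apply: IH => w; apply: e.
Qed.

Lemma bsumD f1 f2 k L :
  bsum (fun w => f1 w + f2 w) k L = bsum f1 k L + bsum f2 k L.
Proof.
elim: L f1 f2 k => [|l L IH] f1 f2 k /=; first by case: ifP; rewrite ?addr0.
by rewrite -big_split; apply: eq_bigr => c _; apply: IH.
Qed.

Lemma bsum_small f k L : (k < sumn L)%N -> bsum f k L = 0.
Proof.
elim: L f k => [|l L IH] f k //= h; apply: big1_seq => c.
by rewrite mem_index_iota => hc; apply: IH; lia.
Qed.

Lemma bsum_sumn f L : bsum f (sumn L) L = f L.
Proof.
elim: L f => [|l L IH] f //=.
rewrite big_ltn ?ltnS ?leq_addr // addKn IH big1_seq ?addr0 // => c.
by rewrite mem_index_iota => hc; rewrite bsum_small //; lia.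
Qed.

Fixpoint ins1 (L : seq nat) : seq (seq nat) :=
  (1%N :: L) :: (if L is l :: L' then [seq l :: x | x <- ins1 L'] else [::]).

Lemma sum_nat_widen (G : nat -> V) l m k : (m <= k)%N ->
  \sum_(l <= c < m.+1) G c = \sum_(0 <= c < k.+1 | (l <= c <= m)%N) G c.
Proof.
move=> mk; rewrite (big_nat_widen _ _ k.+1) ?ltnS // (big_nat_widenl _ 0) //.
by apply: eq_bigl => c; rewrite ltnS andbC.
Qed.

Lemma exchange_triangle (F : nat -> nat -> V) k l1 l2 :
  \sum_(l1 <= a < k.+1) \sum_(l2 <= c < (k - a).+1) F a c =
  \sum_(l2 <= c < k.+1) \sum_(l1 <= a < (k - c).+1) F a c.
Proof.
rewrite !(@sum_nat_widen _ _ k k) //.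
under eq_bigr do rewrite (@sum_nat_widen _ _ _ k) ?leq_subr //.
under [RHS]eq_bigr do rewrite (@sum_nat_widen _ _ _ k) ?leq_subr //.
rewrite (exchange_big_dep (fun c => (l2 <= c <= k)%N)) /=; last first.
  by move=> a c; lia.
by apply: eq_bigr => c hc; apply: eq_bigl => a; lia.
Qed.

(** An s >= l splits as a + c with a >= 1 and c >= l in s - l ways. *)
Lemma sum_triangle (F : nat -> V) k l :
  \sum_(1 <= a < k.+1) \sum_(l <= c < (k - a).+1) F (a + c)%N =
  \sum_(l <= s < k.+1) F s *+ (s - l).
Proof.
elim: k => [|k IH].
  by rewrite big_geq //; case: l => [|l]; rewrite ?big_nat1 // big_geq.
have [lk|kl] := leqP l k.+1; last first.
  rewrite [RHS]big_geq // big1_seq // => a.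
  by rewrite mem_index_iota => ha; rewrite big_geq //; lia.
rewrite [RHS]big_nat_recr //= -IH.
rewrite (@big_nat_recr _ _ _ k.+1) //= subnn.
have -> : \sum_(1 <= a < k.+1) \sum_(l <= c < (k.+1 - a).+1) F (a + c)%N =
  \sum_(1 <= a < k.+1) ((\sum_(l <= c < (k - a).+1) F (a + c)%N) +
     (if (l <= k.+1 - a)%N then F k.+1 else 0)).
  apply: eq_big_nat => a ha.
  have -> : (k.+1 - a = (k - a).+1)%N by lia.
  case: ifP => h; last by rewrite !big_geq ?addr0 //; lia.
  by rewrite big_nat_recr //=; congr (_ + F _); lia.
rewrite big_split /= -addrA; congr (_ + _).
rewrite -big_mkcond /=.
have -> : \sum_(1 <= a < k.+1 | (l <= k.+1 - a)%N) F k.+1 =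
  \sum_(1 <= a < (k.+1 - l).+1 | a != k.+1) F k.+1.
  rewrite [LHS](big_nat_widen _ _ k.+2) // [RHS](big_nat_widen _ _ k.+2) //;
    last by lia.
  by rewrite big_nat_cond [RHS]big_nat_cond; apply: eq_bigl => a; lia.
(* Only for l = 0 does the last a = k.+1 contribute, through c = 0. *)
case: l lk {IH} => [|l] lk.
  rewrite big_nat1 addn0 subn0 big_mkcond big_nat_recr //= eqxx addr0.
  rewrite (eq_big_nat _ _ (F2 := fun=> F k.+1)); last first.
    by move=> a ha; rewrite ifT //; lia.
  by rewrite sumr_const_nat subn1 /= -mulrSr.
rewrite [X in _ + X]big_geq // addr0 big_mkcond.
rewrite (eq_big_nat _ _ (F2 := fun=> F k.+1)); last first.
  by move=> a ha; rewrite ifT //; lia.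
by rewrite sumr_const_nat subn1.
Qed.

(* Merging a into a word yields each word w >= L of weight k once per position j
   and per splitting w_j = a + c with a >= 1 and c >= L_j, hence
   sum_j (w_j - L_j) = k - sumn L times. *)
Lemma bsum_stuffle1 f k L :
  \sum_(1 <= a < k.+1) bsum (fun u => \sum_(v <- stuffle [:: a] u) f v) (k - a) L =
  \sum_(L' <- ins1 L) bsum f k L' + bsum f k L *+ (k - sumn L).
Proof.
elim: L f k => [|l L IH] f k.
  rewrite /= big_seq1 /=; have -> : (if k == 0%N then f [::] else 0) *+ (k - 0) = 0.
    by case: k => [|k] //=; rewrite mul0rn.
  by rewrite addr0; apply: eq_bigr => a _; rewrite big_seq1.
rewrite [ins1 _]/= big_cons big_map -addrA.
(* The inserted a precedes the first letter c, goes into the tail, or merges with c. *)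
transitivity (\sum_(1 <= a < k.+1)
  (\sum_(l <= c < (k - a).+1) bsum (fun w => f (a :: c :: w)) (k - a - c) L +
  (\sum_(l <= c < (k - a).+1)
     bsum (fun w => \sum_(v <- stuffle [:: a] w) f (c :: v)) (k - c - a) L +
   \sum_(l <= c < (k - a).+1) bsum (fun w => f ((a + c)%N :: w)) (k - (a + c)) L))).
  apply: eq_bigr => a _; rewrite -!big_split; apply: eq_bigr => c _ /=.
  rewrite (subnAC k c) subnDA -!bsumD.
  by apply: eq_bsum => w; rewrite big_cons big_cat big_map big_seq1.
rewrite !big_split; congr (_ + _) => /=.
rewrite (exchange_triangle (fun a c => bsum (fun w => \sum_(v <- stuffle [:: a] w) f
  (c :: v)) (k - c - a) L)).
rewrite (sum_triangle (fun s => bsum (fun w => f (s :: w)) (k - s) L)).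
under [X in X + _ = _]eq_bigr => c _ do rewrite (IH (fun v => f (c :: v))).
rewrite big_split -addrA exchange_big /=; congr (_ + _).
rewrite -big_split -sumrMnl; apply: eq_big_nat => c hc /=.
(* Where a subtraction truncates, the sum it multiplies is empty. *)
have [h|h] := ltnP (k - c) (sumn L); first by rewrite bsum_small // !mul0rn addr0.
by rewrite -mulrnDr; congr (_ *+ _); lia.
Qed.

Lemma sum_ins1_nseq (F : seq nat -> V) a :
  \sum_(L <- ins1 (nseq a 1%N)) F L = F (nseq a.+1 1%N) *+ a.+1.
Proof.
elim: a F => [|a IH] F; first by rewrite /= big_seq1.
by rewrite [ins1 _]/= big_cons big_map (IH (fun x => F (1%N :: x))) -mulrS.
Qed.

(** A new 1 has a + 1 places to the left of the 2 and b + 1 to its right. *)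
Lemma sum_ins1 (F : seq nat -> V) a b :
  \sum_(L <- ins1 (nseq a 1%N ++ 2%N :: nseq b 1%N)) F L =
  F (nseq a.+1 1%N ++ 2%N :: nseq b 1%N) *+ a.+1 +
  F (nseq a 1%N ++ 2%N :: nseq b.+1 1%N) *+ b.+1.
Proof.
elim: a F => [|a IH] F.
  rewrite /= big_cons big_map mulr1n; congr (_ + _).
  exact: (sum_ins1_nseq (fun x => F (2%N :: x))).
rewrite [ins1 _]/= big_cons big_map (IH (fun x => F (1%N :: x))) addrA.
by rewrite -mulrS.
Qed.

(** The bound K on the entries is separate from the weight k, so that it stays fixed while the
    induction lowers k. *)
Lemma sum_tuple_bsum f (K k : nat) L : (k <= K)%N ->
  \sum_(t : (size L).-tuple 'I_K.+1 |
     (sumn (index_of t) == k) && all2 leq L (index_of t)) f (index_of t) =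
  bsum f k L.
Proof.
elim: L f k => [|l L IH] f k kK.
  case: k kK => [|k] _ /=; last by rewrite big_pred0 // => t; rewrite tuple0.
  rewrite (big_pred1 [tuple]) // => t; rewrite tuple0; exact/esym/eqP.
rewrite (reindex (fun p : 'I_K.+1 * (size L).-tuple 'I_K.+1 =>
                    [tuple of p.1 :: p.2])) /=; last first.
  exists (fun t => (thead t, [tuple of behead t])) => [[c t]|t] _ /=.
    by rewrite theadE; congr (_, _); apply: val_inj.
  by rewrite -tuple_eta.
rewrite (@sum_nat_widen _ _ _ K) // big_mkord.
transitivity (\sum_(c < K.+1 | (l <= c <= k)%N)
   \sum_(t : (size L).-tuple 'I_K.+1 |
      (sumn (index_of t) == k - c)%N && all2 leq L (index_of t))
      f (nat_of_ord c :: index_of t)).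
  rewrite pair_big_dep /=; apply: eq_big => [[c t]|[c t] _] //=.
  by rewrite -/(index_of t); lia.
by apply: eq_bigr => c hc; rewrite (IH (fun w => f (nat_of_ord c :: w))) //; lia.
Qed.

End Words.

(** * Truncated sums and their asymptotics *)

#[local] Arguments mzv_trunc : simpl never.

Section Truncations.
Variable R : realType.
Implicit Types (s t : seq nat) (u v : nat -> R) (P Q : {poly R}).

Local Notation trunc := (@mzv_trunc R).
Local Notation H := (trunc [:: 1%N]).

Lemma cvg_sum_seq (T : eqType) (r : seq T) (F : T -> nat -> R)
    (l : T -> R) :
  (forall i, i \in r -> F i n @[n --> \oo] --> l i) ->
  \sum_(i <- r) F i n @[n --> \oo] --> \sum_(i <- r) l i.
Proof.
elim: r => [|i r IH] h.
  by rewrite big_nil; under eq_cvg do rewrite big_nil; exact: cvg_cst.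
rewrite big_cons; under eq_cvg do rewrite big_cons.
apply: cvgD; first by apply: h; exact: mem_head.
by apply: IH => j jr; apply: h; rewrite inE jr orbT.
Qed.

Lemma trunc_cons k s n :
  trunc (k :: s) n = \sum_(1 <= m < n) m%:R ^- k * trunc s m.
Proof. by []. Qed.

Lemma trunc_cons1 k s : trunc (k :: s) 1 = 0.
Proof. by rewrite trunc_cons big_geq. Qed.

Lemma trunc_cons0 k s : trunc (k :: s) 0 = 0.
Proof. by rewrite trunc_cons big_geq. Qed.

Lemma trunc_consS k s n :
  trunc (k :: s) n.+2 = trunc (k :: s) n.+1 + n.+1%:R ^- k * trunc s n.+1.
Proof. by rewrite !trunc_cons big_nat_recr. Qed.

Lemma trunc_ge0 s n : 0 <= trunc s n.
Proof.
elim: s n => [|k s IH] n; first exact: ler01.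
rewrite trunc_cons; apply: sumr_ge0 => m _.
by rewrite mulr_ge0 // invr_ge0 exprn_ge0.
Qed.

Lemma le_trunc s : {homo trunc s : m n / (m <= n)%N >-> m <= n}.
Proof.
case: s => [|k s]; first by [].
apply/nondecreasing_seqP => -[|n]; first by rewrite trunc_cons0 trunc_ge0.
by rewrite trunc_consS lerDl mulr_ge0 ?trunc_ge0 // invr_ge0 exprn_ge0.
Qed.

Lemma trunc_stuffle s t n :
  trunc s n * trunc t n = \sum_(w <- stuffle s t) trunc w n.
Proof.
elim: s t n => [|a s IHs] t n; first by rewrite /= big_seq1 mul1r.
elim: t n => [|b t IHt] n; first by rewrite big_seq1 mulr1.
have stE : stuffle (a :: s) (b :: t) = [seq a :: w | w <- stuffle s (b :: t)] ++
   ([seq b :: w | w <- stuffle (a :: s) t] ++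
   [seq (a + b)%N :: w | w <- stuffle s t]) by [].
rewrite stE !big_cat !big_map /=.
(* Both sides vanish for n <= 1; beyond, the increment of the product splits into the three cases of
   the stuffle recursion. *)
elim: n => [|[|n] IH].
- by rewrite !trunc_cons0 mul0r !big1 ?addr0 // => *; rewrite trunc_cons0.
- by rewrite !trunc_cons1 mul0r !big1 ?addr0 // => *; rewrite trunc_cons1.
under eq_bigr do rewrite trunc_consS.
under [X in _ + (X + _)]eq_bigr do rewrite trunc_consS.
under [X in _ + (_ + X)]eq_bigr do rewrite trunc_consS.
rewrite !big_split /= -!mulr_sumr.
rewrite -!IHs -!IHt !trunc_consS exprD invfM.
rewrite mulrDl !mulrDr IH; ring.
Qed.

Lemma trunc_le_H s n : positive_index s -> trunc s n <= H n ^+ size s.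
Proof.
elim: s n => [|k s IH] n; first by rewrite expr0.
move=> /andP[k1 sp]; rewrite [size _]/= trunc_cons exprS [X in X * _]trunc_cons
  mulr_suml; apply: ler_sum_nat => m /andP[m1 mn].
rewrite mulr1 ler_pM ?trunc_ge0 ?invr_ge0 ?exprn_ge0 //.
  rewrite lef_pV2 ?posrE ?exprn_gt0 ?ltr0n //.
  by rewrite ler_weXn2l // ler1n.
apply: le_trans (IH _ sp) _; rewrite lerXn2r ?nnegrE ?trunc_ge0 //.
by apply: (@le_trunc [:: 1%N]); apply: ltnW.
Qed.

Lemma H_gt0 n : 0 < H n.+2.
Proof.
apply: lt_le_trans (@le_trunc [:: 1%N] 2 n.+2 _) => //.
by rewrite trunc_cons big_nat1 invr1 mulr1 ltr01.
Qed.

Lemma H_succ n : H n.+2 = H n.+1 + n.+1%:R^-1.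
Proof. by rewrite trunc_consS mulr1. Qed.

Lemma subXn_le (x y : R) d : 0 <= y -> y <= x ->
  x ^+ d.+1 - y ^+ d.+1 <= d.+1%:R * x ^+ d * (x - y).
Proof.
move=> y0 yx; rewrite subrXX mulrC ler_wpM2r ?subr_ge0 //.
rewrite mulr_natl -[in leRHS](card_ord d.+1) -sumr_const; apply: ler_sum => i _.
rewrite /= -[in leRHS](subnK (ltn_ord i : i <= d)%N) exprD ler_wpM2l //.
  by rewrite exprn_ge0 // (le_trans y0).
by rewrite lerXn2r ?nnegrE // (le_trans y0).
Qed.

(* Summation by parts: the differences of H^d / n reproduce the sum with
   exponent d - 1. *)
Lemma sum_H_bounded d : exists C, forall n,
  \sum_(0 <= i < n) H i.+3 ^+ d / (i.+2%:R * i.+1%:R) + H n.+2 ^+ d / n.+1%:R <= C.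
Proof.
elim: d => [|d [C hC]].
  exists 1 => n; elim: n => [|n IH].
    by rewrite big_geq // add0r expr0 divr1.
  rewrite big_nat_recr //= -addrA; apply: le_trans IH; rewrite lerD2l !expr0.
  rewrite -(natr1 n.+1); set x : R := n.+1%:R.
  have x0 : 0 < x by rewrite ltr0n.
  by rewrite le_eqVlt; apply/orP; left; apply/eqP; field; apply/andP; split; lra.
(* The 1 is the boundary term at n = 0; the factor [d.+1] comes from [subXn_le]. *)
exists (1 + d.+1%:R * C) => n.
apply: (@le_trans _ _ (1 + d.+1%:R *
   \sum_(0 <= i < n) H i.+3 ^+ d / (i.+2%:R * i.+1%:R))); last first.
  rewrite lerD2l ler_wpM2l //; apply: le_trans (hC n); rewrite lerDl.
  by rewrite divr_ge0 // exprn_ge0 // trunc_ge0.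
elim: n => [|n IH].
  rewrite !big_geq // add0r mulr0 addr0 H_succ trunc_cons1 add0r invr1 expr1n.
  by rewrite mulr1.
rewrite !big_nat_recr //=.
set x := H n.+3; set y := H n.+2 in IH *.
have hx : x = y + n.+2%:R^-1 by exact: H_succ.
have yx : y <= x by apply: le_trunc.
have := @subXn_le x y d (trunc_ge0 _ _) yx.
have -> : x - y = n.+2%:R^-1 by rewrite hx addrC addKr.
move=> h.
rewrite -(natr1 n.+1) in h *.
set z : R := n.+1%:R in IH h *.
have z0 : 0 < z by rewrite ltr0n.
(* The new summand and the new boundary term combine, to be compared with the old boundary term
   y^(d+1) / z. *)
have e1 : x ^+ d.+1 / ((z + 1) * z) + x ^+ d.+1 / (z + 1) = x ^+ d.+1 / z.
  by field; apply/andP; split; lra.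
have e2 : d.+1%:R * (x ^+ d / ((z + 1) * z)) = d.+1%:R * x ^+ d / (z + 1) / z.
  by field; apply/andP; split; lra.
have h' : x ^+ d.+1 / z - y ^+ d.+1 / z <= d.+1%:R * x ^+ d / (z + 1) / z.
  by rewrite -mulrBl ler_wpM2r // invr_ge0 ltW.
rewrite -addrA e1 mulrDr e2 addrA.
by apply: le_trans (lerD IH h'); rewrite addrACA subrr addr0.
Qed.

Lemma expH_le d : exists C, forall n, H n.+2 ^+ d <= C * n.+1%:R.
Proof.
have [C hC] := sum_H_bounded d; exists C => n.
rewrite -ler_pdivrMr ?ltr0n //; apply: le_trans (hC n); rewrite lerDr.
apply: sumr_ge0 => i _; rewrite divr_ge0 ?exprn_ge0 ?trunc_ge0 //.
Qed.

(** A convergent majorant: its tails absorb those of admissible truncations even after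
    multiplication by a power of H. *)
Definition Hmajor d n : R := \sum_(1 <= m < n) m%:R ^- 2 * H m.+1 ^+ d.

Lemma Hmajor_term_ge0 d m : 0 <= m%:R ^- 2 * H m.+1 ^+ d :> R.
Proof. by rewrite mulr_ge0 ?invr_ge0 ?exprn_ge0 ?trunc_ge0. Qed.

Lemma le_Hmajor d : {homo Hmajor d : m n / (m <= n)%N >-> m <= n}.
Proof.
apply/nondecreasing_seqP => -[|n]; first by rewrite /Hmajor !big_geq.
by rewrite /Hmajor [leRHS]big_nat_recr //= lerDl Hmajor_term_ge0.
Qed.

Lemma is_cvg_Hmajor d : cvgn (Hmajor d).
Proof.
apply: nondecreasing_is_cvgn; first exact: le_Hmajor.
have [C hC] := sum_H_bounded d; exists (1 + C) => _ [n _ <-].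
apply: (@le_trans _ _ (Hmajor d n.+2)).
  by apply: le_Hmajor; rewrite -addn2 leq_addr.
rewrite /Hmajor big_ltn // lerD //.
  by rewrite H_succ trunc_cons1 add0r !invr1 !expr1n mulr1 invr1.
rewrite -[2%N]/(0 + 2)%N big_addn subn2 /=.
have := hC n; apply: le_trans; rewrite -[leLHS]addr0 lerD //; last first.
  by rewrite divr_ge0 // exprn_ge0 ?trunc_ge0.
apply: ler_sum => i _; rewrite mulrC addn2 ler_wpM2l ?exprn_ge0 ?trunc_ge0 //.
by rewrite expr2 lef_pV2 ?posrE ?mulr_gt0 ?ltr0n // ler_wpM2l // ler_nat.
Qed.

Lemma H_to_infty : H n @[n --> \oo] --> +oo.
Proof.
apply: nondecreasing_dvgn_lt; first exact: le_trunc.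
move=> h; apply: (@dvg_harmonic R).
suff -> : series harmonic = (fun n => H n.+1) by apply/cvg_ex; exists (limn H);
  rewrite cvg_shiftS.
apply/funext => n; rewrite /series /= trunc_cons -[1%N]/(0 + 1)%N big_addn subn1.
by apply: eq_bigr => i _; rewrite mulr1 addn1.
Qed.

Lemma invH_to0 : (H n)^-1 @[n --> \oo] --> 0.
Proof.
apply/gtr0_cvgV0; last exact: H_to_infty.
by exists 2%N => // n /= hn; rewrite -(subnK hn) addn2 H_gt0.
Qed.

(** One spare power of H: [expH_le] at [d.+1] bounds the quotient by a constant over H. *)
Lemma expH_div_to0 d : H n ^+ d / n%:R @[n --> \oo] --> 0.
Proof.
have [C hC] := expH_le d.+1.
apply: (@squeeze_cvgr _ _ _ _ (fun=> 0) (fun n => C * (H n)^-1)).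
- exists 2%N => // n /= hn; rewrite -(subnK hn) addn2.
  set m := (n - 2)%N; rewrite divr_ge0 ?exprn_ge0 ?trunc_ge0 ?ler0n //=.
  have C0 : 0 <= C by have := le_trans (exprn_ge0 d.+1 (trunc_ge0 _ _)) (hC 0%N);
    rewrite mulr1.
  rewrite ler_pdivrMr ?ltr0n // [leRHS]mulrAC ler_pdivlMr ?H_gt0 // -exprSr.
  by apply: le_trans (hC m) _; rewrite ler_wpM2l // ler_nat.
- exact: cvg_cst.
- by rewrite -[X in _ --> X](mulr0 C); apply: cvgMl_tmp; exact: invH_to0.
Qed.

(* u is the polynomial P in H up to an error negligible against powers of H. *)
Definition good u P := forall j,
  (u n - P.[H n]) * H n ^+ j @[n --> \oo] --> 0.

Lemma eq_good u v P : u =1 v -> good u P -> good v P.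
Proof. by move=> e g j; rewrite (_ : v = u)//; apply/funext => n. Qed.

Lemma good_poly P : good (fun n => P.[H n]) P.
Proof. by move=> j; under eq_cvg do rewrite subrr mul0r; apply: cvg_cst. Qed.

Lemma goodD u v P Q : good u P -> good v Q -> good (fun n => u n + v n) (P + Q).
Proof.
move=> gu gv j; rewrite -(addr0 0); under eq_cvg do rewrite hornerD opprD addrACA
  mulrDl.
exact: cvgD (gu j) (gv j).
Qed.

Lemma vanishing_mul_poly u :
  (forall j, u n * H n ^+ j @[n --> \oo] --> 0) ->
  forall Q j, u n * Q.[H n] * H n ^+ j @[n --> \oo] --> 0.
Proof.
move=> hu Q; elim/poly_ind: Q => [|Q c IH] j.
  by under eq_cvg do rewrite horner0 mulr0 mul0r; apply: cvg_cst.
have -> : (fun n => u n * (Q * 'X + c%:P).[H n] * H n ^+ j) =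
          (fun n => u n * Q.[H n] * H n ^+ j.+1 + u n * H n ^+ j * c).
  by apply/funext => n; rewrite !hornerE exprS; ring.
rewrite -(addr0 0) -[X in _ --> _ + X](mul0r c).
by apply: cvgD; [exact: IH|apply: cvgMr_tmp; exact: hu].
Qed.

(** With p = u - P(H) and q = v - Q(H), the error is p q + p Q(H) + q P(H). *)
Lemma goodM u v P Q : good u P -> good v Q -> good (fun n => u n * v n) (P * Q).
Proof.
move=> gu gv j.
have -> : (fun n => (u n * v n - (P * Q).[H n]) * H n ^+ j) =
  (fun n => (u n - P.[H n]) * H n ^+ j * ((v n - Q.[H n]) * H n ^+ 0) +
     ((u n - P.[H n]) * Q.[H n] * H n ^+ j + (v n - Q.[H n]) * P.[H n] * H n ^+ j)).
  by apply/funext => n; rewrite hornerM expr0; ring.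
rewrite -(addr0 0) -[X in X + _](mulr0 0) -[X in _ + X](addr0 0).
apply: cvgD; first exact: cvgM (gu j) (gv 0%N).
by apply: cvgD; exact: vanishing_mul_poly.
Qed.

Lemma goodZ a u P : good u P -> good (fun n => a * u n) (a%:P * P).
Proof.
move=> gu; apply: goodM gu; apply: eq_good (good_poly a%:P) => n.
by rewrite hornerC.
Qed.

Lemma good_sum (I : Type) (r : seq I) (p : pred I) (u : I -> nat -> R) (P : I ->
  {poly R}) :
  (forall i, p i -> good (u i) (P i)) ->
  good (fun n => \sum_(i <- r | p i) u i n) (\sum_(i <- r | p i) P i).
Proof.
move=> h; elim: r => [|i r IH].
  rewrite big_nil; apply: eq_good (good_poly 0) => n.
  by rewrite big_nil horner0.
rewrite big_cons; case: ifP => pi; last first.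
  by apply: eq_good IH => n; rewrite big_cons pi.
by apply: eq_good (goodD (h i pi) IH) => n; rewrite big_cons pi.
Qed.

(** H diverges, so a nonconstant polynomial in H cannot converge. *)
Lemma poly_H_lim P (l : R) : P.[H n] @[n --> \oo] --> l -> P = l%:P.
Proof.
elim/poly_ind: P l => [|P c IH] l.
  move=> h; suff -> : l = 0 by rewrite polyC0.
  apply: (@cvg_unique _ (@Rhausdorff R) _ _ _ _ h).
  by rewrite /=; under eq_cvg do rewrite horner0; apply: cvg_cst.
move=> h.
have P0 : P = 0.
  rewrite (IH 0) ?polyC0 //.
  (* Removing the constant coefficient and dividing by H leaves P(H), which must tend to 0. *)
  have h2 : ((P * 'X + c%:P).[H n] - c) * (H n)^-1 @[n --> \oo] --> (l - c) * 0.
    by apply: cvgM; [apply: cvgB => //; exact: cvg_cst|exact: invH_to0].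
  rewrite mulr0 in h2; apply: cvg_trans h2; apply: near_eq_cvg.
  exists 2%N => // n /= hn; rewrite !hornerE addrK mulfK //.
  by rewrite -(subnK hn) addn2 gt_eqF // H_gt0.
rewrite P0 mul0r add0r; congr _%:P; rewrite P0 in h.
apply: (@cvg_unique _ (@Rhausdorff R) _ _ _ _ _ h).
by rewrite /=; under eq_cvg do rewrite !hornerE; apply: cvg_cst.
Qed.

(** This turns identities between truncations into identities between their asymptotic
    polynomials. *)
Lemma good_uniq u P Q : good u P -> good u Q -> P = Q.
Proof.
move=> gP gQ; apply/eqP; rewrite -subr_eq0; apply/eqP; rewrite -[RHS]polyC0.
apply: poly_H_lim; rewrite -(subr0 0).
have -> : (fun n => (P - Q).[H n]) =
  (fun n => (u n - Q.[H n]) * H n ^+ 0 - (u n - P.[H n]) * H n ^+ 0).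
  by apply/funext => n; rewrite !hornerE; ring.
exact: cvgB (gQ 0%N) (gP 0%N).
Qed.

Lemma good_lim u P (l : R) : good u P -> u n @[n --> \oo] --> l -> P = l%:P.
Proof.
move=> gP h; apply: poly_H_lim; rewrite -(subr0 l).
have -> : (fun n => P.[H n]) = (fun n => u n - (u n - P.[H n]) * H n ^+ 0).
  by apply/funext => n; ring.
exact: cvgB h (gP 0%N).
Qed.

(** In the tail every i is at least m, so [H m] may be replaced by [H i.+1]; the inner truncation
    costs [size s] further powers. *)
Lemma trunc_tail_le k s j m n : (2 <= k)%N -> positive_index s ->
  (1 <= m)%N -> (m <= n)%N ->
  (trunc (k :: s) n - trunc (k :: s) m) * H m ^+ j <=
  Hmajor (size s + j) n - Hmajor (size s + j) m.
Proof.
move=> k2 sp m1 mn; rewrite 2!(trunc_cons k) /Hmajor !(@big_cat_nat _ _ _ m 1 n) //=.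
rewrite [X in X * _]addrAC subrr add0r [leRHS]addrAC subrr add0r mulr_suml;
  apply: ler_sum_nat => i /andP[mi _].
have i0 : (0 < i)%N by apply: leq_trans mi.
rewrite -mulrA exprD ler_pM ?mulr_ge0 ?exprn_ge0 ?trunc_ge0 ?invr_ge0 ?exprn_ge0 //.
  by rewrite lef_pV2 ?posrE ?exprn_gt0 ?ltr0n // ler_weXn2l // ler1n.
rewrite ler_pM ?exprn_ge0 ?trunc_ge0 //.
  apply: le_trans (trunc_le_H _ sp) _.
  by rewrite lerXn2r ?nnegrE ?trunc_ge0 // le_trunc.
by rewrite lerXn2r ?nnegrE ?trunc_ge0 // le_trunc // ltnW.
Qed.

Lemma is_cvg_trunc s : admissible s -> cvgn (trunc s).
Proof.
case: s => [_|k s /andP[/andP[_ sp] k2]]; first exact: is_cvg_cst.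
apply: nondecreasing_is_cvgn; first exact: le_trunc.
exists (limn (Hmajor (size s + 0))) => _ [n _ <-].
case: n => [|n]; first by rewrite trunc_cons0 (le_trans _ (nondecreasing_cvgn_le
  (@le_Hmajor _) (@is_cvg_Hmajor _) 0%N)) // /Hmajor big_geq.
apply: le_trans (nondecreasing_cvgn_le (@le_Hmajor _) (@is_cvg_Hmajor _) n.+1).
have := @trunc_tail_le k s 0 1 n.+1 k2 sp isT isT.
by rewrite trunc_cons1 subr0 expr0 mulr1 [Hmajor _ 1]big_geq // subr0.
Qed.

Lemma trunc_cvg s : admissible s -> trunc s n @[n --> \oo] --> mzv R s.
Proof. exact: is_cvg_trunc. Qed.

(** Up to sign the error is a tail of the series, which even times H^j stays below a tail of the
    convergent [Hmajor]. *)
Lemma good_admissible s : admissible s -> good (trunc s) (mzv R s)%:P.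
Proof.
case: s => [|k s] sa j.
  have -> : mzv R [::] = 1 by exact: (cvg_lim (@Rhausdorff R) (cvg_cst _)).
  by under eq_cvg do rewrite hornerC subrr mul0r; apply: cvg_cst.
have /andP[/andP[_ sp] k2] := sa.
set V := Hmajor (size s + j).
have Vc : V n @[n --> \oo] --> limn V by exact: is_cvg_Hmajor.
rewrite (_ : (fun n => _) = (fun n => - ((mzv R (k :: s) - trunc (k :: s) n) * H n ^+
  j))); last first.
  by apply/funext => n; rewrite hornerC -mulNr opprB.
rewrite -[X in _ --> X]oppr0; apply: cvgN; apply: (@squeeze_cvgr _ _ _ _ (fun=> 0)
  (fun n => limn V - V n)).
- exists 1%N => // m /= m1; apply/andP; split.
    rewrite mulr_ge0 ?exprn_ge0 ?trunc_ge0 // subr_ge0.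
    by apply: nondecreasing_cvgn_le; [exact: le_trunc|exact: is_cvg_trunc].
  apply: (@ler_cvg_to _ \oo _ _ (fun n => (trunc (k :: s) n - trunc (k :: s) m) * H m
    ^+ j) (fun n => V n - V m)).
  - by apply: cvgMr_tmp; apply: cvgB; [exact: trunc_cvg|exact: cvg_cst].
  - by apply: cvgB => //; exact: cvg_cst.
  - by exists m => // n /= mn; apply: trunc_tail_le.
- exact: cvg_cst.
- rewrite -(subrr (limn V)); apply: cvgB => //; exact: cvg_cst.
Qed.

End Truncations.

(** * The connected sum *)

Section Convolution.
Variable A : comNzRingType.
Implicit Types x y z : nat -> A.

(** Coefficient sequences stand for power series: this is multiplication by the variable, and
    [convol] is the product. *)
Definition shift1 x (a : nat) : A := if a is a'.+1 then x a' else 0.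

Definition convol x y (a : nat) : A := \sum_(0 <= j < a.+1) x (a - j)%N * y j.

Lemma convol_shift1l x y a : convol (shift1 x) y a = shift1 (convol x y) a.
Proof.
case: a => [|a]; rewrite /convol; first by rewrite big_nat1 /= mul0r.
rewrite big_nat_recr //= subnn /= mul0r addr0.
by apply: eq_big_nat => j hj; rewrite subSn //; lia.
Qed.

Lemma convol_shift1r x y a : convol x (shift1 y) a = shift1 (convol x y) a.
Proof.
case: a => [|a]; rewrite /convol; first by rewrite big_nat1 /= mulr0.
by rewrite big_nat_recl //= mulr0 add0r.
Qed.

Lemma convolDl x1 x2 y a : convol (fun i => x1 i + x2 i) y a = convol x1 y a + convol
  x2 y a.
Proof. by rewrite -big_split; apply: eq_bigr => j _; rewrite mulrDl. Qed.

Lemma convolDr x y1 y2 a : convol x (fun i => y1 i + y2 i) a = convol x y1 a + convol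
  x y2 a.
Proof. by rewrite -big_split; apply: eq_bigr => j _; rewrite mulrDr. Qed.

Lemma convolZl c x y a : convol (fun i => c * x i) y a = c * convol x y a.
Proof. by rewrite mulr_sumr; apply: eq_bigr => j _; rewrite mulrA. Qed.

Lemma convolZr c x y a : convol x (fun i => c * y i) a = c * convol x y a.
Proof. by rewrite mulr_sumr; apply: eq_bigr => j _; rewrite mulrCA. Qed.

Lemma eq_convol x1 x2 y1 y2 : x1 =1 x2 -> y1 =1 y2 -> convol x1 y1 =1 convol x2 y2.
Proof. by move=> e1 e2 a; apply: eq_bigr => j _; rewrite e1 e2. Qed.

Lemma convol_recl x y a :
  convol x y a = x 0%N * y a + shift1 (convol (fun i => x i.+1) y) a.
Proof.
rewrite /convol big_nat_recr //= subnn addrC; congr (_ + _).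
case: a => [|a] /=; first by rewrite big_geq.
by apply: eq_big_nat => j hj; rewrite subSn //; lia.
Qed.

Lemma convolC x y a : convol x y a = convol y x a.
Proof.
rewrite /convol big_nat_rev; apply: eq_big_nat => j hj.
by rewrite add0n subSS subKn; [exact: mulrC|lia].
Qed.

Lemma convolA x y z a : convol x (convol y z) a = convol (convol x y) z a.
Proof.
elim: a x => [|a IH] x.
  by rewrite /convol !big_nat1 !subnn mulrA.
rewrite convol_recl [in RHS](@eq_convol _
  (fun i => x 0%N * y i + shift1 (convol (fun i => x i.+1) y) i) z z (convol_recl x
    y)) //.
by rewrite convolDl convolZl convol_shift1l /= IH.
Qed.

Lemma convol_sign x y a : (-1) ^+ a * convol x y a =
  convol (fun i => (-1) ^+ i * x i) (fun i => (-1) ^+ i * y i) a.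
Proof.
rewrite /convol mulr_sumr; apply: eq_big_nat => j hj.
rewrite mulrACA -exprD subnK //; lia.
Qed.

End Convolution.

(** * Rising factorials and the evaluation of the inner series *)

Section Connector.
Variable R : realType.
Local Notation trunc := (@mzv_trunc R).
Local Notation H := (trunc [:: 1%N]).

(* Coefficient of y^b in prod_(1 <= r <= n) (1 + y / r). *)
Definition elsym (n b : nat) : R := trunc (nseq b 1%N) n.+1.

(* Coefficient of x^a in prod_(1 <= r <= m) (M + r - x)^-1. *)
Fixpoint hinv (M m : nat) : nat -> R :=
  if m is m'.+1 then
    fix g a := (hinv M m' a + (if a is a'.+1 then g a' else 0)) / (M + m)%:R
  else fun a => (a == 0%N)%:R.

#[local] Arguments hinv : simpl never.

Lemma hinv0E M a : hinv M 0 a = (a == 0%N)%:R.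
Proof. by []. Qed.

Lemma elsymS n b : elsym n.+1 b = elsym n b + n.+1%:R^-1 * shift1 (elsym n) b.
Proof. by case: b => [|b] /=; rewrite /elsym ?mulr0 ?addr0 // trunc_consS. Qed.

Lemma elsym0 b : elsym 0 b = (b == 0%N)%:R.
Proof. by case: b => [|b] //; rewrite /elsym trunc_cons1. Qed.

Lemma elsym_ge0 n b : 0 <= elsym n b. Proof. exact: trunc_ge0. Qed.

Lemma elsym_le n b : elsym n b <= H n.+1 ^+ b.
Proof.
have := @trunc_le_H R (nseq b 1%N) n.+1; rewrite size_nseq; apply.
by rewrite /positive_index all_nseq orbT.
Qed.

Lemma hinvS M m a :
  (M + m.+1)%:R * hinv M m.+1 a = hinv M m a + shift1 (hinv M m.+1) a.
Proof.
have n0 : (M + m.+1)%:R != 0 :> R by rewrite pnatr_eq0 addnS.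
by case: a => [|a] /=; rewrite mulrC divfK.
Qed.

Lemma mulr_exprVS (x : R) j : x != 0 -> x * x ^- j.+1 = x ^- j.
Proof. by move=> x0; rewrite exprS invfM mulrA divff // mul1r. Qed.

Lemma hinv1 M a : hinv M 1 a = M.+1%:R ^- a.+1.
Proof.
have n0 : M.+1%:R != 0 :> R by rewrite pnatr_eq0.
have h a' : M.+1%:R * hinv M 1 a' = (a' == 0%N)%:R + shift1 (hinv M 1) a'.
  by rewrite -(hinv0E M) -hinvS addn1.
elim: a => [|a IH]; apply: (mulfI n0); rewrite h /=.
  by rewrite addr0 expr1 divff.
by rewrite add0r IH mulr_exprVS.
Qed.

(** Peels off the factor r = 1 of the product, where [hinvS] peels off the last one. *)
Lemma hinv_shift m M a :
  M.+1%:R * hinv M m.+1 a = hinv M.+1 m a + shift1 (hinv M m.+1) a.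
Proof.
elim: m a => [|m IHm] a; first by have := hinvS M 0 a; rewrite addn1.
have n0 : (M + m.+2)%:R != 0 :> R by rewrite pnatr_eq0 addnS.
have h a' : (M + m.+2)%:R * hinv M.+1 m.+1 a' = hinv M.+1 m a' + shift1 (hinv M.+1
  m.+1) a'.
  by rewrite -hinvS addSnnS.
elim: a => [|a IHa]; apply: (mulfI n0); rewrite mulrCA hinvS mulrDr IHm mulrDr h /=.
  by rewrite !mulr0 !addr0.
by rewrite hinvS IHa addrACA.
Qed.

Lemma hinv_ge0 M m a : 0 <= hinv M m a.
Proof.
elim: m a => [|m IHm] a; first exact: ler0n.
have n0 : 0 < (M + m.+1)%:R :> R by rewrite ltr0n addnS.
by elim: a => [|a IHa]; rewrite -(pmulr_rge0 _ n0) hinvS addr_ge0.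
Qed.

(** The two ways of peeling differ by (M + m + 1 - x) - (M + 1 - x) = m. *)
Lemma hinv_diff M m a : hinv M m a - hinv M.+1 m a = m%:R * hinv M m.+1 a.
Proof.
have h1 := hinvS M m a; have h2 := hinv_shift m M a.
have : (M + m.+1)%:R = M.+1%:R + m%:R :> R by rewrite -natrD addSnnS.
move=> e; rewrite e in h1; lra.
Qed.

(** Coefficientwise, (M + 1) / (M + 1 - x) <= 1 / (1 - x) and 1 / (M + r - x) <= 1 / (r - x). *)
Lemma hinv_le M m a : M.+1%:R * hinv M m.+1 a <= hinv 0 m.+1 a.
Proof.
elim: m a => [|m IHm] a.
  rewrite !hinv1 expr1n invr1 exprS invfM mulrA divff ?pnatr_eq0 // mul1r.
  by rewrite invf_le1 ?exprn_gt0 ?ltr0n // exprn_ege1 // ler1n.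
have n1 : (0 : R) < m.+2%:R by rewrite ltr0n.
have h a' : M.+1%:R * hinv M m.+1 a' + M.+1%:R * shift1 (hinv M m.+2) a' <=
    hinv 0 m.+1 a' + shift1 (hinv 0 m.+2) a' -> M.+1%:R * hinv M m.+2 a' <= hinv 0
      m.+2 a'.
  move=> h'; rewrite -(ler_pM2l n1) mulrCA; have := hinvS 0 m.+1 a';
    rewrite add0n => ->.
  apply: le_trans h'; rewrite -mulrDr -hinvS ler_wpM2l // ler_wpM2r ?hinv_ge0 //.
  by rewrite ler_nat leq_addl.
by elim: a => [|a IHa]; apply: h; rewrite lerD //= mulr0.
Qed.

(** The left-hand side is the complete symmetric polynomial h_a(1, ..., 1/m), and [H m.+1] is 1 +
    ... + 1/m. *)
Lemma hinv0_le m a : m`!%:R * hinv 0 m a <= H m.+1 ^+ a.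
Proof.
elim: m a => [|m IHm] a.
  by rewrite fact0 mul1r hinv0E; case: a => [|a]; rewrite ?expr0 // exprn_ge0
    ?trunc_ge0.
have e a' : m.+1`!%:R * hinv 0 m.+1 a' = m`!%:R * (hinv 0 m a' + shift1 (hinv 0 m.+1)
  a').
  by rewrite -hinvS add0n factS natrM mulrCA mulrA.
elim: a => [|a IHa]; first by rewrite e /= addr0; apply: le_trans (IHm 0%N) _.
rewrite e mulrDr /= exprS H_succ mulrDl.
apply: lerD.
  apply: le_trans (IHm a.+1) _; rewrite exprS ler_wpM2l ?trunc_ge0 //.
  by rewrite lerXn2r ?nnegrE ?addr_ge0 ?trunc_ge0 ?invr_ge0 // lerDl invr_ge0.
rewrite ler_pdivlMl ?ltr0n // mulrA -natrM -factS -H_succ; exact: IHa.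
Qed.

(** The series prod (1 + x/r) and n! prod 1/(r + x) are inverse to each other. *)
Lemma convol_elsym_hinv n a :
  n`!%:R * convol (elsym n) (fun j => (-1) ^+ j * hinv 0 n j) a = (a == 0%N)%:R.
Proof.
elim: n => [|n IH].
  rewrite fact0 mul1r /convol big_nat_recr //= subnn elsym0 eqxx mul1r.
  rewrite big1_seq ?add0r => [|j]; first by case: a => [|a]; rewrite ?mulr0 // mul1r.
  by rewrite mem_index_iota => hj; rewrite elsym0 (_ : (a - j == 0)%N = false) ?mul0r
    //; lia.
have n0 : n.+1%:R != 0 :> R by rewrite pnatr_eq0.
rewrite factS natrM [X in X * _]mulrC -mulrA -IH; congr (_ * _).
set X := fun j => (-1) ^+ j * hinv 0 n.+1 j.
rewrite -convolZl.
rewrite (@eq_convol _ _ (fun i => n.+1%:R * elsym n i + shift1 (elsym n) i) _ X) //;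
  last first.
  by move=> i; rewrite elsymS mulrDr mulrA divff // mul1r.
rewrite convolDl convolZl convol_shift1l -convolZr.
rewrite (@eq_convol _ _ (elsym n) _ (fun j => (-1) ^+ j * hinv 0 n j + (-1) * shift1
  X j)) //; last first.
  move=> j; rewrite /X mulrCA; have := hinvS 0 n j; rewrite add0n => ->.
  by rewrite mulrDr; congr (_ + _); case: j => [|j] /=; rewrite ?mulr0 // exprS mulrA.
by rewrite convolDr convolZr convol_shift1r mulN1r subrK.
Qed.

(* Coefficient of x^a y^b in sum_(1 <= m <= K) (1/m) (1 + y)_(m-1) / (1 + M - x)_m,
   where (z)_m is the rising factorial: M = 0 gives the series to be evaluated, the
   sum vanishes as M goes to infinity, and its increments in M telescope. *)
Definition csum (K M a b : nat) : R :=
  \sum_(0 <= m < K) m.+1%:R^-1 * (m`!%:R * elsym m b * hinv M m.+1 a).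

Definition csum_diff (K M a b : nat) : R :=
  \sum_(0 <= m < K) m`!%:R * elsym m b * hinv M m.+2 a.

Lemma csumB K M a b : csum K M a b - csum K M.+1 a b = csum_diff K M a b.
Proof.
rewrite /csum /csum_diff -sumrB; apply: eq_bigr => m _.
by rewrite -!mulrBr hinv_diff (mulrCA (m`!%:R * _)) mulKf ?pnatr_eq0.
Qed.

(** For generating series, (M + 1 - x - y) times the sum telescopes over m, from 1 / (M + 1 - x)
    down to the connector at K. *)
Lemma csum_diff_rec K M a b :
  M.+1%:R * csum_diff K M a b =
  shift1 (fun a' => csum_diff K M a' b) a + shift1 (csum_diff K M a) b +
  ((b == 0%N)%:R * M.+1%:R ^- a.+1 - K`!%:R * elsym K b * hinv M K.+1 a).
Proof.
elim: K => [|K IH].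
  rewrite /csum_diff !big_geq // mulr0 fact0 mul1r elsym0 hinv1 subrr addr0.
  by case: a => [|a]; case: b => [|b] /=; rewrite ?big_geq ?addr0.
have -> : csum_diff K.+1 M a b = csum_diff K M a b + K`!%:R * elsym K b * hinv M K.+2 a.
  by rewrite /csum_diff big_nat_recr.
have -> : shift1 (fun a' => csum_diff K.+1 M a' b) a =
   shift1 (fun a' => csum_diff K M a' b) a + K`!%:R * elsym K b * shift1 (hinv M
     K.+2) a.
  by case: a {IH} => [|a] /=; rewrite ?mulr0 ?addr0 // /csum_diff big_nat_recr.
have -> : shift1 (csum_diff K.+1 M a) b =
   shift1 (csum_diff K M a) b + K`!%:R * shift1 (elsym K) b * hinv M K.+2 a.
  by case: b {IH} => [|b] /=; rewrite ?mulr0 ?mul0r ?addr0 // /csum_diff big_nat_recr.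
rewrite mulrDr IH mulrCA hinv_shift elsymS factS natrM.
have := hinv_diff M K.+1 a; set h1 := hinv M K.+1 a; set h2 := hinv M.+1 K.+1 a => hd.
have -> : h2 = h1 - K.+1%:R * hinv M K.+2 a by rewrite -hd subKr.
have n0 : K.+1%:R != 0 :> R by rewrite pnatr_eq0.
rewrite [K.+1%:R * K`!%:R * (_ + _)]mulrDr.
have -> : K.+1%:R * K`!%:R * (K.+1%:R^-1 * shift1 (elsym K) b) = K`!%:R * shift1
  (elsym K) b.
  by rewrite mulrACA divff // mul1r.
ring.
Qed.

Lemma connector_to0 M a b : K`!%:R * elsym K b * hinv M K.+1 a @[K --> \oo] --> 0.
Proof.
(* [hinv0_le] at [K.+1] leaves a factor 1 / (K + 1), and K + 2 <= 2 (K + 1) gives the 2. *)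
apply: (@squeeze_cvgr _ _ _ _ (fun=> 0) (fun K => 2 * (H K.+2 ^+ (a + b) / K.+2%:R))).
- near=> K; apply/andP; split; first by rewrite !mulr_ge0 ?elsym_ge0 ?hinv_ge0.
  have h1 : K.+1%:R * (K`!%:R * hinv M K.+1 a) <= H K.+2 ^+ a.
    apply: le_trans (hinv0_le K.+1 a); rewrite factS natrM -mulrA ler_wpM2l //
      ler_wpM2l //.
    apply: le_trans (hinv_le M K a); rewrite ler_peMl ?hinv_ge0 // ler1n //.
  have h2 : elsym K b <= H K.+2 ^+ b.
    by apply: le_trans (elsym_le _ _) _; rewrite lerXn2r ?nnegrE ?trunc_ge0 // le_trunc.
  have n1 : (0 : R) < K.+1%:R by rewrite ltr0n.
  have n2 : (0 : R) < K.+2%:R by rewrite ltr0n.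
  rewrite mulrAC; apply: (@le_trans _ _ (H K.+2 ^+ a / K.+1%:R * H K.+2 ^+ b)).
    rewrite ler_pM ?mulr_ge0 ?hinv_ge0 ?elsym_ge0 //.
    by rewrite ler_pdivlMr // mulrC.
  rewrite mulrAC -exprD mulrCA ler_wpM2l ?exprn_ge0 ?trunc_ge0 //.
  by rewrite ler_pdivlMr // ler_pdivrMl // -natrM ler_nat; lia.
- exact: cvg_cst.
- rewrite -(mulr0 2); apply: cvgMl_tmp.
  have := @expH_div_to0 R (a + b); rewrite -(@cvg_shiftS _ (fun K => H K ^+ (a + b) /
    K%:R)).
  by rewrite -(@cvg_shiftS _ (fun K => H K.+1 ^+ (a + b) / K.+1%:R)).
Unshelve. all: by end_near.
Qed.

(* Coefficient of x^a y^b in 1 / ((M + 1 - x) (M + 1 - x - y)). *)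
Definition csum_diff_limit (M a b : nat) : R :=
  'C((a + b).+1, a)%:R * M.+1%:R ^- (a + b).+2.

(** Pascal's rule; at b = 0 the last term supplies the missing binomial coefficient. *)
Lemma csum_diff_limit_rec M a b :
  M.+1%:R * csum_diff_limit M a b =
  shift1 (fun a' => csum_diff_limit M a' b) a + shift1 (csum_diff_limit M a) b +
  (b == 0%N)%:R * M.+1%:R ^- a.+1.
Proof.
have n0 : M.+1%:R != 0 :> R by rewrite pnatr_eq0.
rewrite /csum_diff_limit mulrCA mulr_exprVS //.
case: a => [|a]; case: b => [|b] /=.
- by rewrite bin0 !add0r.
- by rewrite !bin0 !add0n add0r mul0r addr0.
- by rewrite !addn0 addr0 -mulrDl !binSn -natr1.
- by rewrite !addSn !addnS mul0r addr0 -mulrDl -natrD; congr (_%:R * _);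
  rewrite [LHS]binS [LHS]addnC.
Qed.

(** Double induction on a and b: the recursions for the sum and for its limit differ only by the
    connector, which vanishes. *)
Lemma csum_diff_cvg M a b : csum_diff K M a b @[K --> \oo] --> csum_diff_limit M a b.
Proof.
have n0 : M.+1%:R != 0 :> R by rewrite pnatr_eq0.
have step a' b' :
    shift1 (fun a => csum_diff K M a b') a' @[K --> \oo] --> shift1 (fun a =>
      csum_diff_limit M a b') a' ->
    shift1 (csum_diff K M a') b' @[K --> \oo] --> shift1 (csum_diff_limit M a') b' ->
    csum_diff K M a' b' @[K --> \oo] --> csum_diff_limit M a' b'.
  move=> h1 h2.
  rewrite -[csum_diff_limit _ _ _](mulKf n0) csum_diff_limit_rec.
  have -> : (fun K => csum_diff K M a' b') = (fun K => M.+1%:R^-1 *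
      (shift1 (fun a => csum_diff K M a b') a' + shift1 (csum_diff K M a') b' +
      ((b' == 0%N)%:R * M.+1%:R ^- a'.+1 - K`!%:R * elsym K b' * hinv M K.+1 a'))).
    by apply/funext => K; rewrite -csum_diff_rec mulKf.
  apply: cvgMl_tmp; apply: cvgD; first exact: cvgD.
  rewrite -[X in _ --> X]subr0; apply: cvgB; first exact: cvg_cst.
  exact: connector_to0.
elim: a b => [|a IHa]; elim=> [|b IHb]; apply: step => //=; exact: cvg_cst.
Qed.

Lemma csum_diff_le K M a b : csum_diff K M a b <= csum_diff_limit M a b.
Proof.
rewrite -(cvg_lim (@Rhausdorff R) (@csum_diff_cvg M a b)).
apply: (@nondecreasing_cvgn_le R (fun K => csum_diff K M a b)).
  apply/nondecreasing_seqP => n; rewrite /csum_diff big_nat_recr //= lerDl.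
  by rewrite !mulr_ge0 ?elsym_ge0 ?hinv_ge0.
by apply/cvg_ex; exists (csum_diff_limit M a b); exact: csum_diff_cvg.
Qed.

Lemma csum_ge0 K M a b : 0 <= csum K M a b.
Proof.
apply: sumr_ge0 => m _.
by rewrite mulr_ge0 ?invr_ge0 // !mulr_ge0 ?elsym_ge0 ?hinv_ge0.
Qed.

Lemma csum_le K M a b : csum K M a b <= csum K 0 a b / M.+1%:R.
Proof.
rewrite mulr_suml; apply: ler_sum => m _; rewrite -!mulrA ler_wpM2l ?invr_ge0 //.
rewrite ler_wpM2l // ler_wpM2l ?elsym_ge0 // ler_pdivlMr ?ltr0n // mulrC.
exact: hinv_le.
Qed.

Lemma csum_telescope K N a b :
  csum K 0 a b - csum K N a b = \sum_(0 <= M < N) csum_diff K M a b.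
Proof.
elim: N => [|N IH]; first by rewrite subrr big_geq.
by rewrite big_nat_recr //= -IH -csumB addrA subrK.
Qed.

Lemma sum_csum_diff_limit N a b : \sum_(0 <= M < N) csum_diff_limit M a b =
  'C((a + b).+1, a)%:R * trunc [:: (a + b).+2] N.+1.
Proof.
rewrite trunc_cons -[1%N]/(0 + 1)%N big_addn subn1 mulr_sumr.
by apply: eq_bigr => M _; rewrite addn1 mulr1.
Qed.

Lemma csum_cvg a b :
  csum K 0 a b @[K --> \oo] --> 'C((a + b).+1, a)%:R * mzv R [:: (a + b).+2].
Proof.
set B : R := 'C((a + b).+1, a)%:R; set k := (a + b).+2.
have zc : B * trunc [:: k] N.+1 @[N --> \oo] --> B * mzv R [:: k].
  by apply: cvgMl_tmp; rewrite (@cvg_shiftS _ (trunc [:: k])); exact: trunc_cvg.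
(* At fixed K the remainder [csum K N a b] is O(1/N), and each increment is at most its limit. *)
have ub K : csum K 0 a b <= B * mzv R [:: k].
  apply: (@ler_cvg_to _ \oo _ _
    (fun N => csum K 0 a b - csum K 0 a b * N.+1%:R^-1)
    (fun N => B * trunc [:: k] N.+1) _ _ _ zc).
    rewrite -[X in _ --> X]subr0 -[X in _ --> _ - X](mulr0 (csum K 0 a b)).
    by apply: cvgB; [exact: cvg_cst|apply: cvgMl_tmp; exact: cvg_harmonic].
  near=> N; rewrite -sum_csum_diff_limit.
  apply: (@le_trans _ _ (csum K 0 a b - csum K N a b));
    first by rewrite lerD2l lerN2 csum_le.
  by rewrite csum_telescope; apply: ler_sum => M _; exact: csum_diff_le.
have nd : nondecreasing_seq (fun K => csum K 0 a b).
  apply/nondecreasing_seqP => n; rewrite /csum big_nat_recr //= lerDl.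
  by rewrite mulr_ge0 ?invr_ge0 // !mulr_ge0 ?elsym_ge0 ?hinv_ge0.
have ic : cvgn (fun K => csum K 0 a b).
  by apply: nondecreasing_is_cvgn => //; exists (B * mzv R [:: k]) => _ [n _ <-].
have sc N : \sum_(0 <= M < N) csum_diff K M a b @[K --> \oo] -->
    \sum_(0 <= M < N) csum_diff_limit M a b.
  apply: (@cvg_sum_seq _ _ _ (fun M K => csum_diff K M a b)) => M _.
  exact: csum_diff_cvg.
suff <- : limn (fun K => csum K 0 a b) = B * mzv R [:: k] by [].
apply/eqP; rewrite eq_le; apply/andP; split.
  by apply: limr_le => //; apply: nearW.
(* Conversely, at fixed N the remainder is nonnegative, so K may go to infinity first. *)
apply: (@cvgr_to_le _ \oo _ _ _ _ _ zc); near=> N; rewrite -sum_csum_diff_limit.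
apply: (@ler_cvg_to _ \oo _ _ _ _ _ _ (sc N) ic); near=> K.
by rewrite -csum_telescope gerBl csum_ge0.
Unshelve. all: by end_near.
Qed.

(** With m the variable carrying the 2, the product of the (1 + x/r) over m < r <= n is the one over
    r <= n times the inverse of the one over r <= m, whose coefficients are (-1)^j h_j(1, ...,
    1/m). *)
Lemma trunc_ones_two a b n :
  trunc (nseq a 1%N ++ 2%N :: nseq b 1%N) n.+1 =
  convol (elsym n) (fun j => (-1) ^+ j * csum n 0 j b) a.
Proof.
elim: n a => [|n IH] a.
  have -> : trunc (nseq a 1%N ++ 2%N :: nseq b 1%N) 1 = 0.
    by case: a => [|a]; exact: trunc_cons1.
  by rewrite /convol big1 // => j _; rewrite /csum big_geq // !mulr0.
set z := fun a => trunc (nseq a 1%N ++ 2%N :: nseq b 1%N) n.+1.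
have -> : trunc (nseq a 1%N ++ 2%N :: nseq b 1%N) n.+2 =
    z a + (n.+1%:R^-1 * shift1 z a + (a == 0%N)%:R * (n.+1%:R ^- 2 * elsym n b)).
  case: a => [|a]; rewrite trunc_consS /=; first by rewrite mulr0 add0r mul1r.
  by rewrite mul0r addr0.
pose k : R := n.+1%:R^-1 * (n`!%:R * elsym n b).
rewrite (@eq_convol _ _ (elsym n.+1) _
  (fun j => (-1) ^+ j * csum n 0 j b + k * ((-1) ^+ j * hinv 0 n.+1 j))) //; last first.
  by move=> j; rewrite /csum big_nat_recr //= mulrDr /k; congr (_ + _); ring.
rewrite convolDr convolZr.
(* The summand added to [csum] meets the full product, so only its constant coefficient survives. *)
have -> : k * convol (elsym n.+1) (fun j => (-1) ^+ j * hinv 0 n.+1 j) a =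
    (a == 0%N)%:R * (n.+1%:R ^- 2 * elsym n b).
  rewrite -(convol_elsym_hinv n.+1 a) /k factS natrM; set c := convol _ _ _.
  have n0 : n.+1%:R != 0 :> R by rewrite pnatr_eq0.
  by rewrite expr2; field.
rewrite addrA; congr (_ + _).
rewrite (@eq_convol _ _ (fun i => elsym n i + n.+1%:R^-1 * shift1 (elsym n) i) _
   (fun j => (-1) ^+ j * csum n 0 j b)) //; last exact: elsymS.
rewrite convolDl convolZl convol_shift1l -IH /z; congr (_ + _ * _).
by case: a => [|a] //=; rewrite -IH.
Qed.

End Connector.

(** * Regularization *)

Section Reduction.
Implicit Types s t w : seq nat.

Fixpoint leading_ones s : nat :=
  if s is 1%N :: s' then (leading_ones s').+1 else 0%N.

Lemma stuffle_cons_cons a s b t : stuffle (a :: s) (b :: t) =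
  [seq a :: w | w <- stuffle s (b :: t)] ++
  ([seq b :: w | w <- stuffle (a :: s) t] ++
   [seq (a + b)%N :: w | w <- stuffle s t]).
Proof. by []. Qed.

Lemma positive_cons k s : positive_index (k :: s) = (0 < k)%N && positive_index s.
Proof. by []. Qed.

Lemma positive_stuffle s t : positive_index s -> positive_index t ->
  all positive_index (stuffle s t).
Proof.
elim: s t => [|a s IHs] t; first by rewrite /= andbT.
move=> /[dup] ps; rewrite positive_cons => /andP[a0 hs].
elim: t => [|b t IHt]; first by rewrite [all _ _]/= ?andbT.
move=> /[dup] pt; rewrite positive_cons => /andP[b0 ht]; apply/allP => w.
rewrite stuffle_cons_cons !mem_cat => /or3P[] /mapP[x hx ->]; rewrite positive_cons.
- by rewrite a0; apply: (allP (IHs _ hs pt)) hx.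
- by rewrite b0; apply: (allP (IHt ht)) hx.
- by rewrite addn_gt0 a0; apply: (allP (IHs _ hs ht)) hx.
Qed.

Lemma admissible_stuffle s t : admissible s -> admissible t ->
  all admissible (stuffle s t).
Proof.
move=> /[dup] as_ /andP[ps hs] /[dup] at_ /andP[pt ht]; apply/allP => w hw.
rewrite /admissible (allP (positive_stuffle ps pt)) //=.
move: hw; case: s {as_ ps} hs => [|a s] hs; first by rewrite inE => /eqP ->.
case: t {at_ pt} ht => [|b t] ht; first by rewrite inE => /eqP ->.
rewrite stuffle_cons_cons !mem_cat => /or3P[] /mapP[x _ ->] //=.
by rewrite (leq_trans hs) // leq_addr.
Qed.

Lemma leading_ones0 s : positive_index s -> leading_ones s = 0%N -> admissible s.
Proof. by case: s => [|[|[|k]] s] // ps _; rewrite /admissible ps. Qed.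

Lemma leading_onesS s n : leading_ones s = n.+1 ->
  exists2 t, s = 1%N :: t & leading_ones t = n.
Proof. by case: s => [|[|[|k]] s] //= [<-]; exists s. Qed.

(** Inserting 1 next to a leading one or in front gives [1 :: t]; inserting it later or merging it
    adds no leading one. *)
Lemma stuffle_one t : positive_index t -> exists2 r : seq (seq nat),
  perm_eq (stuffle [:: 1%N] t) (nseq (leading_ones t).+1 (1%N :: t) ++ r) &
  forall w, w \in r -> positive_index w /\ (leading_ones w <= leading_ones t)%N.
Proof.
elim: t => [|b t IH]; first by exists [::].
move=> /[dup] pt; rewrite positive_cons => /andP[b0 ht].
have pbt : positive_index ((1 + b)%N :: t) by rewrite positive_cons.
case: b => [|[|b]] // in b0 pt pbt *.
  have [r hp hr] := IH ht.
  exists ([seq 1%N :: w | w <- r] ++ [:: 2%N :: t]) => [|w].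
    have -> : nseq (leading_ones (1%N :: t)).+1 [:: 1%N, 1%N & t] ++
        [seq 1%N :: w | w <- r] ++ [:: 2%N :: t] = [:: 1%N, 1%N & t] ::
        ([seq 1%N :: w | w <- nseq (leading_ones t).+1 (1%N :: t) ++ r] ++ [:: 2%N ::
          t]).
      by rewrite map_cat map_nseq -catA.
    by rewrite stuffle_cons_cons perm_cons perm_cat2r; exact: perm_map.
  rewrite mem_cat => /orP[/mapP[x /hr [px lx] ->]|].
    by split => //; rewrite positive_cons px.
  by rewrite inE => /eqP ->; split.
exists ([seq b.+2 :: w | w <- stuffle [:: 1%N] t] ++ [:: (1 + b.+2)%N :: t]) => [|w].
  by rewrite stuffle_cons_cons.
rewrite mem_cat => /orP[/mapP[x hx ->]|].
  by split => //; rewrite positive_cons; apply: (allP (positive_stuffle _ ht)) hx.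
by rewrite inE => /eqP ->; split.
Qed.

(* [1] * t equals 1 :: t, with multiplicity, plus words with fewer leading
   ones: solving for 1 :: t is the usual regularization algorithm. *)
Lemma regularization_ind (P : seq nat -> Prop) :
  (forall s, admissible s -> P s) ->
  (forall n t (r : seq (seq nat)), positive_index t ->
     perm_eq (stuffle [:: 1%N] t) (nseq n.+1 (1%N :: t) ++ r) ->
     P t -> (forall w, w \in r -> P w) -> P (1%N :: t)) ->
  forall s, positive_index s -> P s.
Proof.
move=> Padm Pone s; move: {2}(leading_ones s) (leqnn (leading_ones s)) => n.
elim: n s => [|n IH] s; first by rewrite leqn0 => /eqP h ps; apply/Padm/leading_ones0.
rewrite leq_eqVlt => /orP[/eqP|]; last exact: IH.
move=> /leading_onesS[t -> lt]; rewrite positive_cons => /andP[_ pt];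
  have [r hp hr] := stuffle_one pt.
apply: (Pone _ _ _ pt hp); first by apply: IH; rewrite ?lt.
by move=> w /hr[pw lw]; apply: IH; rewrite // -lt.
Qed.

Lemma sum_stuffle_one (V : nmodType) (f : seq nat -> V) n t r :
  perm_eq (stuffle [:: 1%N] t) (nseq n.+1 (1%N :: t) ++ r) ->
  \sum_(w <- stuffle [:: 1%N] t) f w = f (1%N :: t) *+ n.+1 + \sum_(w <- r) f w.
Proof. by move=> hp; rewrite (perm_big _ hp) big_cat big_nseq iter_addr_0. Qed.

Lemma sumn_stuffle s t w : w \in stuffle s t -> sumn w = (sumn s + sumn t)%N.
Proof.
elim: s t w => [|a s IHs] t w; first by rewrite inE => /eqP ->.
elim: t w => [|b t IHt] w; first by rewrite inE addn0 => /eqP ->.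
rewrite stuffle_cons_cons !mem_cat => /or3P[] /mapP[x hx ->] /=.
- by rewrite (IHs _ _ hx) /= addnA.
- by rewrite (IHt _ hx) /= addnCA.
- by rewrite (IHs _ _ hx) addnACA.
Qed.

Lemma positive_cat u v : positive_index (u ++ v) = positive_index u && positive_index v.
Proof. exact: all_cat. Qed.

Lemma positive_rev u : positive_index (rev u) = positive_index u.
Proof. exact: all_rev. Qed.

Lemma positive_nseq n k : (0 < k)%N -> positive_index (nseq n k).
Proof. by move=> k0; rewrite /positive_index all_nseq k0 orbT. Qed.

Lemma positive_ones_two a b : positive_index (nseq a 1%N ++ 2%N :: nseq b 1%N).
Proof. by rewrite /positive_index all_cat /= !all_nseq !orbT. Qed.

Lemma all2_leq_ones b s : size s = b -> all2 leq (nseq b 1%N) s = positive_index s.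
Proof. by elim: b s => [|b IH] [|c s] //= [/IH ->]. Qed.

Lemma all2_leq_ones_two a b s : size s = (a + b.+1)%N ->
  all2 leq (nseq a 1%N ++ 2%N :: nseq b 1%N) s =
  positive_index s && (2 <= nth 0%N s a)%N.
Proof.
elim: a s => [|a IH] [|c s] // [hs]; last first.
  by rewrite [LHS]/= IH // positive_cons andbA.
rewrite [LHS]/= all2_leq_ones // positive_cons andbC; case: (positive_index s) => //=.
  by rewrite andbT; case: c => [|[|c]].
by rewrite !andbF.
Qed.

End Reduction.

(** * Existence of the regularization and its values on the words 1^a 2 1^b *)

Section Regularization.
Variable R : realType.
Implicit Types (s t w : seq nat).
Local Notation trunc := (@mzv_trunc R).
Local Notation H := (trunc [:: 1%N]).
Local Notation zs := (zeta_star R).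

Lemma good_H : good H 'X.
Proof. by apply: eq_good (good_poly 'X) => n; rewrite hornerX. Qed.

Lemma good_sum_seq (I : eqType) (r : seq I) (u : I -> nat -> R) (P : I -> {poly R}) :
  (forall i, i \in r -> good (u i) (P i)) ->
  good (fun n => \sum_(i <- r) u i n) (\sum_(i <- r) P i).
Proof.
move=> h; rewrite big_seq; apply: eq_good (good_sum _ h) => n.
by rewrite [RHS]big_seq.
Qed.

Lemma good_cons_one n t (r : seq (seq nat)) P (Q : seq nat -> {poly R}) :
  perm_eq (stuffle [:: 1%N] t) (nseq n.+1 (1%N :: t) ++ r) ->
  good (trunc t) P -> (forall w, w \in r -> good (trunc w) (Q w)) ->
  good (trunc (1%N :: t)) (n.+1%:R^-1%:P * ('X * P + (-1)%:P * \sum_(w <- r) Q w)).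
Proof.
move=> hp gP gQ.
have := goodZ n.+1%:R^-1 (goodD (goodM good_H gP) (goodZ (-1) (good_sum_seq gQ))).
apply: eq_good => N /=; rewrite trunc_stuffle (sum_stuffle_one _ hp).
by rewrite mulN1r addrK -[X in _ * X]mulr_natl mulKf ?pnatr_eq0.
Qed.

Lemma good_trunc_ex s : positive_index s -> exists P, good (trunc s) P.
Proof.
move: s; apply: regularization_ind => [s sa|n t r _ hp [P gP] gr].
  by exists (mzv R s)%:P; exact: good_admissible.
pose Q w := xget 0 [set P | good (trunc w) P].
have gQ w : w \in r -> good (trunc w) (Q w).
  by move=> /gr; rewrite /Q => h; apply: (xgetPex 0 h).
by eexists; exact: good_cons_one hp gP gQ.
Qed.

(** The asymptotic polynomials of the truncations are a witness: by [good_uniq] they inherit the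
    stuffle product. *)
Lemma harmonic_regP : is_harmonic_reg (harmonic_reg R).
Proof.
apply: (@xgetPex _ _ [set Z | @is_harmonic_reg R Z]).
pose Z s := xget 0 [set P | good (trunc s) P].
have gZ s : positive_index s -> good (trunc s) (Z s).
  by move=> /good_trunc_ex h; apply: (xgetPex 0 h).
exists Z; split=> [|s sa|s t ps pt].
- exact: good_uniq (gZ [:: 1%N] isT) good_H.
- by apply: good_uniq (gZ _ _) (good_admissible sa); case/andP: sa.
- apply: good_uniq (goodM (gZ _ ps) (gZ _ pt)) _.
  apply: eq_good (good_sum_seq _) => [n|w hw]; first by rewrite trunc_stuffle.
  by apply: gZ; apply: (allP (positive_stuffle ps pt)).
Qed.

(** The map chosen by [xget] is known only through its axioms; these impose the regularization
    algorithm, which the asymptotic polynomials obey as well. *)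
Lemma good_harmonic_reg s : positive_index s -> good (trunc s) (harmonic_reg R s).
Proof.
have [Z1 Za ZM] := harmonic_regP.
move: s; apply: regularization_ind => [s sa|n t r pt hp gt gr].
  by rewrite Za //; exact: good_admissible.
suff -> : harmonic_reg R (1%N :: t) = n.+1%:R^-1%:P *
   ('X * harmonic_reg R t + (-1)%:P * \sum_(w <- r) harmonic_reg R w).
  exact: good_cons_one hp gt gr.
rewrite -Z1 ZM // (sum_stuffle_one _ hp) polyCN polyC1 mulN1r addrK mulrnAr -mulrnAl.
by rewrite -polyCMn -[X in X%:P]mulr_natr mulVf ?pnatr_eq0 // polyC1 mul1r.
Qed.

Lemma zeta_star1 : zs [:: 1%N] = 0.
Proof. by have [Z1 _ _] := harmonic_regP; rewrite /zeta_star Z1 hornerX. Qed.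

Lemma zeta_star_mzv s : admissible s -> zs s = mzv R s.
Proof. by have [_ Za _] := harmonic_regP; move=> sa;
  rewrite /zeta_star Za // hornerC. Qed.

Lemma zeta_star_stuffle s t : positive_index s -> positive_index t ->
  zs s * zs t = \sum_(w <- stuffle s t) zs w.
Proof.
have [_ _ ZM] := harmonic_regP.
by move=> ps pt; rewrite /zeta_star -hornerM ZM // horner_sum.
Qed.

Lemma zeta_star_nil : zs [::] = 1.
Proof.
rewrite zeta_star_mzv //; exact: (cvg_lim (@Rhausdorff R) (cvg_cst _)).
Qed.

(* Value of sum_m m^-2 h_a(1, ..., 1/m) e_b(1, ..., 1/(m-1)). *)
Definition mixed_sum a b : R := 'C((a + b).+1, a)%:R * mzv R [:: (a + b).+2].

Lemma trunc_ones_two_pred a b n : trunc (nseq a 1%N ++ 2%N :: nseq b 1%N) n =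
  convol (fun i => trunc (nseq i 1%N) n) (fun j => (-1) ^+ j * csum R n.-1 0 j b) a.
Proof.
case: n => [|n]; last exact: trunc_ones_two.
rewrite (_ : trunc _ 0 = 0); last by case: a => [|a]; exact: trunc_cons0.
by rewrite /convol big1 // => j _; rewrite /csum big_geq // !mulr0.
Qed.

(** [csum_cvg] gives a limit but no rate. Solving [trunc_ones_two_pred] for its last summand shows
    by induction that some asymptotic polynomial exists, and convergence forces it to be the
    constant limit. *)
Lemma good_csum a b : good (fun n => csum R n.-1 0 a b) (mixed_sum a b)%:P.
Proof.
elim/ltn_ind: a => a IH.
have lim : csum R n.-1 0 a b @[n --> \oo] --> mixed_sum a b.
  by rewrite -(@cvg_shiftS _ (fun n => csum R n.-1 0 a b)); exact: csum_cvg.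
suff [P gP] : exists P, good (fun n => csum R n.-1 0 a b) P.
  by rewrite -(good_lim gP lim).
pose S : nat -> nat -> R := fun j n => (trunc (nseq (a - j) 1%N) n) * ((-1) ^+ j *
  csum R n.-1 0 j b).
pose Q j : {poly R} := harmonic_reg R (nseq (a - j) 1%N) * (((-1) ^+ j)%:P *
  (mixed_sum j b)%:P).
have gS : good (fun n => \sum_(j <- index_iota 0 a) S j n) (\sum_(j <- index_iota 0
  a) Q j).
  apply: good_sum_seq => j; rewrite mem_index_iota => /andP[_ ja].
  by apply: goodM; [exact/good_harmonic_reg/positive_nseq|apply: goodZ; exact: IH].
eexists; apply: eq_good (goodZ ((-1) ^+ a) (goodD (good_harmonic_reg
  (positive_ones_two a b)) (goodZ (-1) gS))) => n.
rewrite trunc_ones_two_pred /convol big_nat_recr //= subnn mul1r mulN1r [X in _ *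
  X]addrAC subrr add0r.
by rewrite mulrA -expr2 sqrr_sign mul1r.
Qed.

Lemma zeta_star_ones_two a b : zs (nseq a 1%N ++ 2%N :: nseq b 1%N) =
  convol (fun i => zs (nseq i 1%N)) (fun j => (-1) ^+ j * mixed_sum j b) a.
Proof.
have gc : good (trunc (nseq a 1%N ++ 2%N :: nseq b 1%N))
    (\sum_(j <- index_iota 0 a.+1) harmonic_reg R (nseq (a - j) 1%N) *
        (((-1) ^+ j)%:P * (mixed_sum j b)%:P)).
  apply: eq_good (good_sum_seq (u := fun j n => trunc (nseq (a - j) 1%N) n *
      ((-1) ^+ j * csum R n.-1 0 j b)) _) => [n|j _];
        first by rewrite trunc_ones_two_pred.
  by apply: goodM; [exact/good_harmonic_reg/positive_nseq|apply: goodZ;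
    exact: good_csum].
rewrite /zeta_star (good_uniq (good_harmonic_reg (positive_ones_two a b)) gc)
  horner_sum.
by apply: eq_bigr => j _; rewrite !hornerE.
Qed.

Lemma mzv_stuffle s t : admissible s -> admissible t ->
  mzv R s * mzv R t = \sum_(w <- stuffle s t) mzv R w.
Proof.
move=> sa ta; have [/andP[ps _] /andP[pt _]] := (sa, ta).
rewrite -!zeta_star_mzv // zeta_star_stuffle // big_seq [RHS]big_seq.
by apply: eq_bigr => w hw; rewrite zeta_star_mzv //;
  apply: (allP (admissible_stuffle sa ta)).
Qed.

(** * The algebra of multiple zeta values and the ideal of zeta(2) *)

Local Notation Zs := (@mzv_space R).
Local Notation I := (@zeta2_ideal R).

Lemma mzv_space0 : Zs 0.
Proof. by exists [::] => //; rewrite big_nil. Qed.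

Lemma mzv_spaceD x y : Zs x -> Zs y -> Zs (x + y).
Proof.
move=> [c ca ->] [d da ->]; exists (c ++ d); first by rewrite all_cat ca.
by rewrite big_cat.
Qed.

Lemma mzv_spaceZ (q : rat) x : Zs x -> Zs (ratr q * x).
Proof.
move=> [c ca ->]; exists [seq (q * p.1, p.2) | p <- c]; first by rewrite all_map.
by rewrite big_map mulr_sumr; apply: eq_bigr => p _; rewrite /= rmorphM /= mulrA.
Qed.

Lemma mzv_space_sum (T : eqType) (r : seq T) (F : T -> R) :
  (forall i, i \in r -> Zs (F i)) -> Zs (\sum_(i <- r) F i).
Proof.
move=> h; rewrite big_seq; elim/big_rec: _ => [|i x ir hx]; first exact: mzv_space0.
by apply: mzv_spaceD hx; exact: h.
Qed.

Lemma mzv_space_mzv s : admissible s -> Zs (mzv R s).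
Proof.
by move=> sa; exists [:: (1, s)] => /=; rewrite ?sa // big_seq1 rmorph1 mul1r.
Qed.

Lemma mzv_spaceM x y : Zs x -> Zs y -> Zs (x * y).
Proof.
move=> [c /allP ca ->] [d /allP da ->]; rewrite mulr_suml.
apply: mzv_space_sum => p pc; rewrite -mulrA; apply: mzv_spaceZ.
rewrite mulr_sumr; apply: mzv_space_sum => q qd; rewrite mulrCA; apply: mzv_spaceZ.
have [pa qa] := (ca _ pc, da _ qd); rewrite mzv_stuffle //;
  apply: mzv_space_sum => w hw.
by apply: mzv_space_mzv; apply: (allP (admissible_stuffle pa qa)).
Qed.

Lemma mzv_space_rat (q : rat) : Zs (ratr q).
Proof.
rewrite -[ratr q]mulr1 -zeta_star_nil zeta_star_mzv //.
by apply: mzv_spaceZ; exact: mzv_space_mzv.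
Qed.

Lemma mzv_space_int (m : int) : Zs m%:~R.
Proof. by rewrite -ratr_int; exact: mzv_space_rat. Qed.

Lemma mzv_space_sign n : Zs ((-1) ^+ n).
Proof. by have := mzv_space_int ((-1) ^+ n); rewrite rmorphXn rmorphN1. Qed.

(** As [zs [:: 1]] is 0, stuffling with 1 expresses [zs (1 :: t)] rationally through words covered
    by induction. *)
Lemma mzv_space_zeta_star s : positive_index s -> Zs (zs s).
Proof.
move: s; apply: regularization_ind => [s sa|n t r pt hp _ hr].
  by rewrite zeta_star_mzv //; exact: mzv_space_mzv.
suff -> : zs (1%N :: t) = ratr (- n.+1%:R^-1) * \sum_(w <- r) zs w.
  by apply: mzv_spaceZ; exact: mzv_space_sum.
have := zeta_star_stuffle (isT : positive_index [:: 1%N]) pt.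
rewrite (sum_stuffle_one _ hp) zeta_star1 mul0r rmorphN fmorphV rmorph_nat /=.
move=> /esym /eqP; rewrite addrC addr_eq0 => /eqP ->.
by rewrite mulrNN -[X in _ * X]mulr_natl mulKf ?pnatr_eq0.
Qed.

Lemma zeta2_ideal0 : I 0.
Proof. by exists 0; [exact: mzv_space0|rewrite mulr0]. Qed.

Lemma zeta2_idealD x y : I x -> I y -> I (x + y).
Proof.
by move=> [a ha <-] [b hb <-]; exists (a + b); [exact: mzv_spaceD|rewrite mulrDr].
Qed.

Lemma zeta2_idealMl x y : Zs x -> I y -> I (x * y).
Proof.
by move=> hx [b hb <-]; exists (x * b); [exact: mzv_spaceM|rewrite mulrCA].
Qed.

Lemma zeta2_idealMr x y : I x -> Zs y -> I (x * y).
Proof. by move=> hx hy; rewrite mulrC; exact: zeta2_idealMl. Qed.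

Lemma zeta2_idealN x : I x -> I (- x).
Proof. by move=> hx; rewrite -mulN1r; apply: zeta2_idealMl => //;
  exact: (mzv_space_sign 1). Qed.

Lemma zeta2_idealB x y : I x -> I y -> I (x - y).
Proof. by move=> hx hy; apply: zeta2_idealD => //; exact: zeta2_idealN. Qed.

Lemma zeta2_ideal_sum (T : eqType) (r : seq T) (F : T -> R) :
  (forall i, i \in r -> I (F i)) -> I (\sum_(i <- r) F i).
Proof.
move=> h; rewrite big_seq; elim/big_rec: _ => [|i x ir hx]; first exact: zeta2_ideal0.
by apply: zeta2_idealD hx; exact: h.
Qed.

End Regularization.

(** * Even zeta values *)

Section EvenZeta.
Variable R : realType.
Local Notation trunc := (@mzv_trunc R).
Local Notation H := (trunc [:: 1%N]).

(** For m > 0 this tends to 3 / (4 m^2), the source of the 3/2 in [even_zeta_sum]. *)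
Definition partial_sum_ne (m N : nat) : R :=
  \sum_(1 <= l < N.+1 | l != m) (l%:R ^+ 2 - m%:R ^+ 2)^-1.

Lemma partial_fraction (l m : R) : 0 < m -> 0 < l -> l != m ->
  (l ^+ 2 - m ^+ 2)^-1 = (2 * m)^-1 * ((l - m)^-1 - (l + m)^-1).
Proof.
move=> m0 l0 lm; have lm' : l - m != 0 by rewrite subr_eq0.
have lp : l + m != 0 by rewrite gt_eqF // addr_gt0.
by rewrite subr_sqr; field; rewrite ?lm' ?lp ?gt_eqF.
Qed.

Lemma partial_sum_neS m N : N.+1 != m -> partial_sum_ne m N.+1 =
  partial_sum_ne m N + (N.+1%:R ^+ 2 - m%:R ^+ 2)^-1.
Proof.
by move=> h; rewrite /partial_sum_ne big_mkcond big_nat_recr //= h -big_mkcond.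
Qed.

Lemma partial_sum_ne_lt m N : (N < m)%N -> partial_sum_ne m N =
  (2 * m%:R)^-1 * (H (m - N) - H m + H m.+1 - H (N + m).+1).
Proof.
elim: N => [|N IH] Nm.
  rewrite /partial_sum_ne big_geq // subn0 add0n; ring.
rewrite partial_sum_neS; last by rewrite neq_ltn Nm.
rewrite IH; last by apply: ltnW.
rewrite partial_fraction ?ltr0n //; [|lia|by rewrite eqr_nat; lia].
rewrite -mulrDr; congr (_ * _).
have -> : (m - N = (m - N.+1).+1)%N by lia.
have e : (m - N.+1 = (m - N.+2).+1)%N by lia.
rewrite e H_succ -e addSn H_succ natrB; last by apply: ltnW.
have -> : (N + m).+1%:R = N.+1%:R + m%:R :> R by rewrite -natrD.
have -> : (N.+1%:R - m%:R)^-1 = - (m%:R - N.+1%:R)^-1 :> R by rewrite -invrN opprB.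
ring.
Qed.

(** Past the omitted l = m, telescoping leaves 3 / (4 m^2) minus 1 / (2 m) times the sum of the 2 m
    reciprocals from d + 1 to d + 2 m. *)
Lemma partial_sum_ne_ge m d : (0 < m)%N -> partial_sum_ne m (m + d) =
  (2 * m%:R)^-1 * (3 / (2 * m%:R) - (H (m + d + m).+1 - H d.+1)).
Proof.
move=> m0; have mR : 0 < m%:R :> R by rewrite ltr0n.
elim: d => [|d IH].
  case: m m0 mR => // m _ mR.
  rewrite addn0 /partial_sum_ne big_mkcond big_nat_recr //= eqxx addr0 -big_mkcond.
  have -> : \sum_(1 <= i < m.+1 | i != m.+1) (i%:R ^+ 2 - m.+1%:R ^+ 2)^-1 =
     partial_sum_ne m.+1 m by [].
  rewrite partial_sum_ne_lt // subSnn trunc_cons1 !(addnS, addSn) !H_succ.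
  rewrite (_ : (m + m).+2%:R = 2 * m.+1%:R :> R); last by rewrite -natrM; congr _%:R;
    lia.
  set u := (m + m).+1%:R^-1; set x := m.+1%:R in mR *; congr (_ * _); field; lra.
rewrite addnS partial_sum_neS; last by lia.
rewrite IH partial_fraction ?ltr0n //; [|by rewrite eqr_nat; lia].
rewrite -mulrDr; congr (_ * _); rewrite addSn !H_succ -natrD -natrB; last by lia.
have -> : ((m + d).+1 - m = d.+1)%N by lia.
rewrite addSn; ring.
Qed.

Lemma H_sub_le (a b : nat) : H (a + b).+1 - H a.+1 <= b%:R / a.+1%:R.
Proof.
elim: b => [|b IH]; first by rewrite addn0 subrr mul0r.
rewrite addnS H_succ -[X in _ <= X / _]natr1 mulrDl mul1r addrAC lerD //.
by rewrite lef_pV2 ?posrE ?ltr0n // ler_nat ltnS leq_addr.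
Qed.

(** A geometric sum in x = m^-2 and y = l^-2, where x - y = (l^2 - m^2) x y. *)
Lemma geometric_sum (m l p : nat) : (0 < m)%N -> (0 < l)%N -> l != m ->
  \sum_(1 <= k < p.+2) m%:R ^- (2 * k) * l%:R ^- (2 * (p.+2 - k)) =
  (m%:R ^- (2 * p.+1) - l%:R ^- (2 * p.+1)) * (l%:R ^+ 2 - m%:R ^+ 2)^-1 :> R.
Proof.
move=> m0 l0 lm.
have mR : m%:R != 0 :> R by rewrite pnatr_eq0 -lt0n.
have lR : l%:R != 0 :> R by rewrite pnatr_eq0 -lt0n.
have d0 : l%:R ^+ 2 - m%:R ^+ 2 != 0 :> R.
  by rewrite subr_eq0 eqrXn2 ?ler0n // eqr_nat.
apply: (mulIf d0); rewrite mulfVK //.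
pose x : R := m%:R ^- 2; pose y : R := l%:R ^- 2.
have ex j : m%:R ^- (2 * j) = x ^+ j :> R by rewrite exprM exprVn.
have ey j : l%:R ^- (2 * j) = y ^+ j :> R by rewrite exprM exprVn.
have -> : l%:R ^+ 2 - m%:R ^+ 2 = (x - y) / (x * y) :> R.
  rewrite /x /y; field; rewrite ?mR ?lR //.
have xy0 : x * y != 0 by rewrite mulf_neq0 // invr_eq0 expf_neq0.
have key : x ^+ p.+1 - y ^+ p.+1 = (x - y) * \sum_(i < p.+1) y ^+ (p - i) * x ^+ i.
  by rewrite -[LHS]opprB subrXX -mulNr opprB.
rewrite !ex !ey key big_add1 big_mkord /=.
have -> : \sum_(i < p.+1) m%:R ^- (2 * i.+1) / l%:R ^+ (2 * (p.+2 - i.+1)) =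
    x * y * \sum_(i < p.+1) y ^+ (p - i) * x ^+ i.
  rewrite mulr_sumr; apply: eq_bigr => i _; rewrite ex ey subSS exprS subSn ?exprS;
    last by have := ltn_ord i.
  ring.
by rewrite mulrC mulrA mulfVK.
Qed.

(** The diagonal l = m gives the first term; off it, swapping l and m exchanges the two halves of
    [geometric_sum], hence the 2. *)
Lemma even_sum_partial (p N : nat) :
  \sum_(1 <= k < p.+2) trunc [:: (2 * k)%N] N.+1 * trunc [:: (2 * (p.+2 - k))%N] N.+1 =
  p.+1%:R * trunc [:: (2 * p.+2)%N] N.+1 +
  2 * \sum_(1 <= m < N.+1) m%:R ^- (2 * p.+1) * partial_sum_ne m N.
Proof.
have -> : \sum_(1 <= k < p.+2) trunc [:: (2 * k)%N] N.+1 * trunc [:: (2 * (p.+2 -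
  k))%N] N.+1 =
  \sum_(1 <= m < N.+1) \sum_(1 <= l < N.+1) \sum_(1 <= k < p.+2)
    m%:R ^- (2 * k) * l%:R ^- (2 * (p.+2 - k)) :> R.
  under eq_bigr do rewrite !trunc_cons mulr_suml.
  rewrite exchange_big; apply: eq_bigr => m _ /=; rewrite exchange_big;
    apply: eq_bigr => k _ /=.
  by rewrite mulr_sumr; apply: eq_bigr => l _; rewrite !mulr1.
pose F m l : R := m%:R ^- (2 * p.+1) * (l%:R ^+ 2 - m%:R ^+ 2)^-1.
have -> : \sum_(1 <= m < N.+1) \sum_(1 <= l < N.+1) \sum_(1 <= k < p.+2)
    m%:R ^- (2 * k) * l%:R ^- (2 * (p.+2 - k)) =
   \sum_(1 <= m < N.+1) (p.+1%:R * m%:R ^- (2 * p.+2) +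
      \sum_(1 <= l < N.+1 | l != m) (F m l + F l m)).
  apply: eq_big_nat => m /andP[m0 mN].
  rewrite (bigD1_seq m) ?mem_index_iota ?m0 ?iota_uniq //=; congr (_ + _).
    rewrite (eq_big_nat _ _ (F2 := fun=> m%:R ^- (2 * p.+2))).
      by rewrite sumr_const_nat subn1 mulr_natl.
    by move=> k hk; rewrite -invfM -exprD; congr (_ ^- _); lia.
  rewrite big_nat_cond [RHS]big_nat_cond; apply: eq_bigr => l /andP[/andP[l0 _] lm].
  rewrite geometric_sum // /F mulrBl; congr (_ + _).
  by rewrite -mulrN -invrN opprB.
rewrite big_split -mulr_sumr; congr (_ + _).
  by rewrite trunc_cons; congr (_ * _); apply: eq_bigr => m _; rewrite mulr1.
under eq_bigr do rewrite big_split.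
rewrite big_split /= [X in _ + X](exchange_big_dep xpredT) //=.
have E : \sum_(1 <= m < N.+1) m%:R ^- (2 * p.+1) * partial_sum_ne m N =
   \sum_(1 <= m < N.+1) \sum_(1 <= l < N.+1 | l != m) F m l.
  by apply: eq_bigr => m _; rewrite mulr_sumr.
rewrite E mulr_natl mulr2n; congr (_ + _).
by apply: eq_bigr => m _; apply: eq_bigl => l; rewrite eq_sym.
Qed.

(** Euler's formula: with n = p + 2 the constant is n + 1/2. *)
Lemma even_zeta_sum p :
  \sum_(1 <= k < p.+2) mzv R [:: (2 * k)%N] * mzv R [:: (2 * (p.+2 - k))%N] =
  (p.+1%:R + 3 / 2) * mzv R [:: (2 * p.+2)%N].
Proof.
have tc k : (2 <= k)%N -> trunc [:: k] N.+1 @[N --> \oo] --> mzv R [:: k].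
  move=> k2; rewrite (@cvg_shiftS _ (trunc [:: k])); apply: trunc_cvg.
  by rewrite /admissible /= k2 andbT; lia.
(* Collects the remainders of [partial_sum_ne_ge], with N = m + d. *)
pose E N : R := \sum_(1 <= m < N.+1) m%:R ^- (2 * p.+1) *
   (m%:R^-1 * (H (N + m).+1 - H (N - m).+1)).
have E0 : E N @[N --> \oo] --> 0.
  apply: (@squeeze_cvgr _ _ _ _ (fun=> 0) (fun N => 4 * (H N.+1 ^+ 1 / N.+1%:R))).
  - near=> N; apply/andP; split.
      apply: sumr_ge0 => m _; rewrite mulr_ge0 ?invr_ge0 ?exprn_ge0 // mulr_ge0
        ?invr_ge0 //.
      by rewrite subr_ge0 le_trunc // ltnS; lia.
    (* Each term is at most 2 / (m (N + 1 - m)); by partial fractions both parts sum to harmonic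
       numbers. *)
    apply: (@le_trans _ _ (\sum_(1 <= m < N.+1) 2 / N.+1%:R * (m%:R^-1 + (N.+1 -
      m)%:R^-1))).
      apply: ler_sum_nat => m /andP[m1 mN].
      have mR : 0 < m%:R :> R by rewrite ltr0n.
      have h1 : H (N + m).+1 - H (N - m).+1 <= (2 * m%:R) / (N.+1 - m)%:R :> R.
        have := H_sub_le (N - m) (2 * m).
        rewrite (_ : (N - m + 2 * m = N + m)%N); last by lia.
        by rewrite natrM subSn.
      apply: (@le_trans _ _ (m%:R^-1 * (m%:R^-1 * ((2 * m%:R) / (N.+1 - m)%:R)))).
        rewrite ler_pM ?invr_ge0 ?exprn_ge0 ?mulr_ge0 ?invr_ge0 ?subr_ge0 ?le_trunc
          //; [by lia| |].
          by rewrite lef_pV2 ?posrE ?exprn_gt0 // -[leLHS]expr1 ler_weXn2l ?ler1n //;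
            lia.
        by rewrite ler_wpM2l ?invr_ge0.
      have nR : 0 < (N.+1 - m)%:R :> R by rewrite ltr0n; lia.
      have -> : N.+1%:R = m%:R + (N.+1 - m)%:R :> R by rewrite -natrD subnKC // ltnW.
      rewrite le_eqVlt; apply/orP; left; apply/eqP; field; lra.
    rewrite -mulr_sumr big_split /=.
    have -> : \sum_(1 <= m < N.+1) m%:R^-1 = H N.+1 by rewrite trunc_cons;
      apply: eq_bigr => m _; rewrite mulr1.
    rewrite [X in _ + X]big_nat_rev /=.
    have -> : \sum_(1 <= m < N.+1) (N.+1 - (1 + N.+1 - m.+1))%:R^-1 = H N.+1.
      rewrite trunc_cons; apply: eq_big_nat => m hm; rewrite mulr1; congr (_%:R^-1);
        lia.
    by rewrite le_eqVlt; apply/orP; left; apply/eqP; rewrite expr1; ring.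
  - exact: cvg_cst.
  - rewrite -(mulr0 4); apply: cvgMl_tmp.
    by rewrite (@cvg_shiftS _ (fun N => H N ^+ 1 / N%:R)); exact: expH_div_to0.
have SE N : \sum_(1 <= k < p.+2) trunc [:: (2 * k)%N] N.+1 * trunc [:: (2 * (p.+2 -
  k))%N] N.+1 =
   (p.+1%:R + 3 / 2) * trunc [:: (2 * p.+2)%N] N.+1 - E N.
  rewrite even_sum_partial (mulrDl p.+1%:R) -addrA; congr (_ + _).
  rewrite trunc_cons /E !mulr_sumr -sumrB; apply: eq_big_nat => m /andP[m1 mN].
  have mR : m%:R != 0 :> R by rewrite pnatr_eq0; lia.
  have := @partial_sum_ne_ge m (N - m) m1; rewrite subnKC // => ->.
  rewrite mulr1 (_ : (2 * p.+2 = (2 * p.+1).+2)%N); last by lia.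
  rewrite [m%:R ^+ _.+2]exprS exprS; set y : R := m%:R ^+ _.
  have y0 : y != 0 by rewrite expf_neq0.
  by field; rewrite y0 mR.
have l1 : (fun N => \sum_(1 <= k < p.+2) trunc [:: (2 * k)%N] N.+1 * trunc [:: (2 *
  (p.+2 - k))%N] N.+1) @ \oo
   --> (p.+1%:R + 3 / 2) * mzv R [:: (2 * p.+2)%N] - 0.
  under eq_cvg do rewrite SE.
  by apply: cvgB => //; apply: cvgMl_tmp; exact: tc.
have l2 : (fun N => \sum_(1 <= k < p.+2) trunc [:: (2 * k)%N] N.+1 * trunc [:: (2 *
  (p.+2 - k))%N] N.+1) @ \oo
   --> \sum_(1 <= k < p.+2) mzv R [:: (2 * k)%N] * mzv R [:: (2 * (p.+2 - k))%N].
  apply: (@cvg_sum_seq _ _ _ (fun k N => trunc [:: (2 * k)%N] N.+1 * trunc [:: (2 *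
    (p.+2 - k))%N] N.+1)) => k.
  by rewrite mem_index_iota => hk; apply: cvgM; apply: tc; lia.
rewrite subr0 in l1; exact: (cvg_unique (@Rhausdorff R) l2 l1).
Unshelve. all: by end_near.
Qed.

(** Euler's formula expresses zeta(2p + 4) rationally through products of lower even zeta values. *)
Lemma zeta2_ideal_even n : zeta2_ideal (mzv R [:: (2 * n.+1)%N]).
Proof.
elim/ltn_ind: n => -[|p] IH.
  exists 1; last by rewrite mulr1.
  by have := mzv_space_int R 1.
have c0 : p.+1%:R + 3 / 2 != 0 :> R by rewrite gt_eqF // addr_gt0 ?ltr0n // divr_gt0.
rewrite -[mzv _ _](mulKf c0) -even_zeta_sum.
have -> : (p.+1%:R + 3 / 2)^-1 = ratr ((p.+1%:R + 3 / 2)^-1) :> R.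
  by rewrite fmorphV rmorphD /= rmorph_nat fmorph_div /= !rmorph_nat.
apply: zeta2_idealMl; first exact: mzv_space_rat.
apply: zeta2_ideal_sum => k; rewrite mem_index_iota => hk.
case: k hk => // k hk; apply: zeta2_idealMr; first by apply: IH; lia.
by apply: mzv_space_mzv; rewrite /admissible /=; lia.
Qed.

End EvenZeta.

(** * The sum formula *)

Section SymmetricMZV.
Variable R : realType.
Local Notation zs := (zeta_star R).
Local Notation zF := (zeta_star_F R).
Local Notation Zs := (@mzv_space R).
Local Notation I := (@zeta2_ideal R).

Lemma zeta_star_F_deconc w :
  zF w = deconc (fun u v => (-1) ^+ sumn u * zs (rev u) * zs v) w.
Proof. by []. Qed.

Lemma mzv_space_zeta_star_F w : positive_index w -> Zs (zF w).
Proof.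
move=> pw; rewrite zeta_star_F_deconc; apply: mzv_space_sum => j _.
move: pw; rewrite -{1}(cat_take_drop j w) positive_cat => /andP[pu pv].
apply: mzv_spaceM; last exact: mzv_space_zeta_star.
apply: mzv_spaceM; first exact: mzv_space_sign.
by apply: mzv_space_zeta_star; rewrite positive_rev.
Qed.

(** An a stuffled into the suffix contributes [zs [:: a]]; in the reversed prefix it contributes the
    same with the sign (-1)^a. *)
Lemma zeta_star_F_stuffle1 a w : (0 < a)%N -> positive_index w ->
  \sum_(v <- stuffle [:: a] w) zF v = (1 + (-1) ^+ a) * zs [:: a] * zF w.
Proof.
move=> a0 pw; have pa : positive_index [:: a] by rewrite positive_cons a0.
under eq_bigr do rewrite zeta_star_F_deconc.
rewrite deconc_stuffle1 zeta_star_F_deconc [in RHS]/deconc mulr_sumr.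
apply: (@eq_in_deconc _ _ (fun u v => (1 + (-1) ^+ a) * zs [:: a] * ((-1) ^+ sumn u *
  zs (rev u) * zs v))) => u v e.
move: pw; rewrite e positive_cat => /andP[pu pv].
rewrite -mulr_suml -mulr_sumr -(zeta_star_stuffle R pa pv).
have -> : \sum_(x <- stuffle [:: a] u) (-1) ^+ sumn x * zs (rev x) =
    (-1) ^+ a * (-1) ^+ sumn u * (zs [:: a] * zs (rev u)).
  rewrite (zeta_star_stuffle R pa) ?positive_rev // -(sum_stuffle1_rev zs) mulr_sumr.
  rewrite big_seq [RHS]big_seq; apply: eq_bigr => x /sumn_stuffle ->.
  by rewrite /= addn0 exprD.
ring.
Qed.

(** For odd a, including the regularized a = 1, the factor vanishes; even zeta values lie in the
    ideal. *)
Lemma zeta2_ideal_parity a : (0 < a)%N -> I ((1 + (-1) ^+ a) * zs [:: a]).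
Proof.
move=> a0; have [oa|ea] := boolP (odd a).
  by rewrite -signr_odd oa expr1 subrr mul0r; exact: zeta2_ideal0.
case: a a0 ea => [|[|a]] // _ ea.
have -> : (a.+2 = 2 * (a./2).+1)%N by move: (even_halfK ea); rewrite /= => h; lia.
rewrite zeta_star_mzv; last by rewrite /admissible /=; lia.
apply: zeta2_idealMl; last exact: zeta2_ideal_even.
by apply: mzv_spaceD; [exact: (mzv_space_int R 1)|exact: mzv_space_sign].
Qed.

Lemma zeta2_ideal_bsum (f : seq nat -> R) k L : positive_index L ->
  (forall w, positive_index w -> I (f w)) -> I (bsum f k L).
Proof.
elim: L f k => [|l L IH] f k; first by move=> _ h /=; case: ifP => _;
  [exact: h|exact: zeta2_ideal0].
rewrite positive_cons => /andP[l0 pL] h /=; apply: zeta2_ideal_sum => c.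
rewrite mem_index_iota => hc; apply: IH => // w pw; apply: h.
by rewrite positive_cons pw andbT; lia.
Qed.

(** [zeta_star_F_stuffle1] summed over a and over the words above L; [bsum_stuffle1] counts the
    words that arise. *)
Lemma zeta2_ideal_relation k L : positive_index L ->
  I (\sum_(L' <- ins1 L) bsum zF k L' + bsum zF k L *+ (k - sumn L)).
Proof.
move=> pL; rewrite -bsum_stuffle1; apply: zeta2_ideal_sum => a.
rewrite mem_index_iota => ha; apply: zeta2_ideal_bsum => // u pu.
rewrite zeta_star_F_stuffle1 //; last by lia.
apply: zeta2_idealMr; last exact: mzv_space_zeta_star_F.
by apply: zeta2_ideal_parity; lia.
Qed.

Lemma zeta2_ideal_cancel n x : I (x *+ n.+1) -> I x.
Proof.
move=> h; have -> : x = ratr (n.+1%:R^-1) * (x *+ n.+1).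
  by rewrite fmorphV rmorph_nat -[X in _ * X]mulr_natl mulKf ?pnatr_eq0.
by apply: zeta2_idealMl => //; exact: mzv_space_rat.
Qed.

Lemma zeta2_ideal_nat n x : I x -> I (x *+ n).
Proof.
move=> h; rewrite -mulr_natl; apply: zeta2_idealMl => //.
by have := mzv_space_int R n.
Qed.

(** For L = 1^n the relation links n + 1 times the sum of length n + 1 to the sum of length n, and
    the sum of length 0 is empty as k > 0. *)
Lemma zeta2_ideal_symmetric_sum k n : (0 < k)%N -> I (bsum zF k (nseq n 1%N)).
Proof.
move=> k0; elim: n => [|n IH].
  by rewrite /= ifF; [exact: zeta2_ideal0|case: k k0].
apply: (@zeta2_ideal_cancel n).
have := zeta2_ideal_relation k (positive_nseq n (isT : (0 < 1)%N)).
rewrite sum_ins1_nseq => h.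
rewrite -(addrK (bsum zF k (nseq n 1%N) *+ (k - sumn (nseq n 1%N))) (_ *+ _)).
by apply: zeta2_idealB => //; exact: zeta2_ideal_nat.
Qed.

(** * Symmetric values at words of ones with at most one 2 *)

Local Notation ones := (fun i => zs (nseq i 1%N)).
Local Notation sones := (fun i => (-1) ^+ i * zs (nseq i 1%N)).

Lemma sumn_ones n : sumn (nseq n 1%N) = n.
Proof. by rewrite sumn_nseq mul1n. Qed.

Lemma rev_ones n : rev (nseq n 1%N) = nseq n 1%N.
Proof. by elim: n => // n IH; rewrite /= rev_cons IH -cats1 -[[:: 1%N]]/(nseq 1 1%N)
  -nseqD addn1. Qed.

Lemma rev_ones_two a b :
  rev (nseq a 1%N ++ 2%N :: nseq b 1%N) = nseq b 1%N ++ 2%N :: nseq a 1%N.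
Proof. by rewrite rev_cat rev_cons !rev_ones cat_rcons. Qed.

(* The generating function of zeta_star (1, ..., 1) is P with P(-x) P(x) = 1
   modulo zeta(2). *)
Lemma zeta2_ideal_ones n : (0 < n)%N -> I (convol ones sones n).
Proof.
(* In weight n and length n the only word is 1^n. *)
move=> n0; have := zeta2_ideal_symmetric_sum n n0.
rewrite -[in X in bsum _ X](sumn_ones n) bsum_sumn zeta_star_F_deconc deconc_nseq.
congr (I _); apply: eq_bigr => j _.
by rewrite sumn_ones rev_ones mulrC.
Qed.

Lemma convol_ones_unit y a : (forall j, Zs (y j)) ->
  I (convol (convol ones sones) y a - y a).
Proof.
move=> hy; rewrite convol_recl.
have -> : convol ones sones 0 = 1.
  by rewrite /convol big_nat1 /= zeta_star_nil !mul1r.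
rewrite mul1r addrC addKr; case: a => [|a] /=; first exact: zeta2_ideal0.
apply: zeta2_ideal_sum => j _; apply: zeta2_idealMr => //.
exact: zeta2_ideal_ones.
Qed.

Lemma mzv_space_mixed_sum a b : Zs (mixed_sum R a b).
Proof.
apply: mzv_spaceM; first by have := mzv_space_int R 'C((a + b).+1, a).
by apply: mzv_space_mzv.
Qed.

Lemma zeta_star_F_ones_two a b :
  I (zF (nseq a 1%N ++ 2%N :: nseq b 1%N) -
     (-1) ^+ a * (mixed_sum R a b + mixed_sum R b a)).
Proof.
pose q b j : R := (-1) ^+ j * mixed_sum R j b.
have zq b' : (fun j => zs (nseq j 1%N ++ 2%N :: nseq b' 1%N)) =1 convol ones (q b').
  by move=> j; rewrite zeta_star_ones_two.
rewrite zeta_star_F_deconc deconc_ones_two mulrDr opprD addrACA.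
apply: zeta2_idealD.
  (* Cuts before the 2: P(-x) from the prefixes cancels the P(x) of [zeta_star_ones_two]. *)
  have -> : \sum_(0 <= j < a.+1) (-1) ^+ sumn (nseq j 1%N) * zs (rev (nseq j 1%N)) *
      zs (nseq (a - j) 1%N ++ 2%N :: nseq b 1%N) = convol (convol ones sones) (q b) a.
    rewrite convolC convolA (@eq_convol _ _ (convol ones (q b)) sones sones (convolC
      _ _)) //.
    by apply: eq_bigr => j _; rewrite sumn_ones rev_ones -(zq b) mulrC.
  apply: convol_ones_unit => j; apply: mzv_spaceM; first exact: mzv_space_sign.
  exact: mzv_space_mixed_sum.
(* Cuts after the 2: the reversed prefix is 1^j 2 1^a, and its sign turns P(x) into P(-x). *)
have -> : \sum_(0 <= j < b.+1) (-1) ^+ sumn (nseq a 1%N ++ 2%N :: nseq j 1%N) *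
    zs (rev (nseq a 1%N ++ 2%N :: nseq j 1%N)) * zs (nseq (b - j) 1%N) =
    (-1) ^+ a * convol (convol ones sones) (fun j => mixed_sum R j a) b.
  rewrite -convolA (@eq_convol _ ones ones _
    (fun j => (-1) ^+ j * zs (nseq j 1%N ++ 2%N :: nseq a 1%N))) //; last first.
    move=> j; rewrite zq convol_sign; apply: eq_convol => // i.
    by rewrite /q mulrA -expr2 sqrr_sign mul1r.
  rewrite /convol mulr_sumr; apply: eq_bigr => j _.
  rewrite rev_ones_two sumn_cat /= !sumn_ones exprD exprD sqrrN expr1n mul1r.
  ring.
rewrite -mulrBr; apply: zeta2_idealMl; first exact: mzv_space_sign.
by apply: convol_ones_unit => j; exact: mzv_space_mixed_sum.
Qed.

(** The coefficient of the theorem for a = i - 1 and b = n - i, hence n = a + b + 1. *)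
Definition sum_formula_coeff (k a b : nat) : R :=
  (-1) ^+ a * ('C(k - 1, a)%:R + (-1) ^+ (a + b + 1) * 'C(k - 1, b)%:R).

(** Absorption, (j + 1) C(k - 1, j + 1) = (k - 1 - j) C(k - 1, j), at j = a and j = b. *)
Lemma sum_formula_coeff_rec a b d (k := (a + b + 2 + d.+1)%N) :
  sum_formula_coeff k a.+1 b *+ a.+1 + sum_formula_coeff k a b.+1 *+ b.+1 +
  sum_formula_coeff k a b *+ d.+1 = 0.
Proof.
have := mul_bin_left (k - 1) a; have := mul_bin_left (k - 1) b.
have -> : (k - 1 - a = b + d + 2)%N by rewrite /k; lia.
have -> : (k - 1 - b = a + d + 2)%N by rewrite /k; lia.
move=> /(congr1 (fun n => n%:R : R)); rewrite !natrM => hb.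
move=> /(congr1 (fun n => n%:R : R)); rewrite !natrM => ha.
rewrite /sum_formula_coeff !(addSn, addnS) !addn0 !exprS.
set A0 : R := 'C(k - 1, a)%:R in ha *; set A1 : R := 'C(k - 1, a.+1)%:R in ha *.
set B0 : R := 'C(k - 1, b)%:R in hb *; set B1 : R := 'C(k - 1, b.+1)%:R in hb *.
transitivity ((-1) ^+ a * ((b + d + 2)%:R * A0 - a.+1%:R * A1 +
   (-1) ^+ (a + b) * (b.+1%:R * B1 - (a + d + 2)%:R * B0)) : R).
  ring.
by rewrite ha hb !subrr mulr0 addr0 mulr0.
Qed.

(** Induction on d = k - 1 - n, so that the base case is the single word 1^a 2 1^b. *)
Lemma sum_formula_ones_two d a b (k := (a + b + 2 + d)%N) :
  I (bsum zF k (nseq a 1%N ++ 2%N :: nseq b 1%N) -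
     sum_formula_coeff k a b * mzv R [:: k]).
Proof.
rewrite /k {k}; elim: d a b => [|d IH] a b.
  set L := nseq a 1%N ++ 2%N :: nseq b 1%N; have sL : sumn L = (a + b + 2 + 0)%N.
    by rewrite sumn_cat /= !sumn_ones; lia.
  rewrite -[in X in bsum _ X]sL bsum_sumn.
  have := zeta_star_F_ones_two a b; rewrite -/L.
  rewrite /mixed_sum [(b + a)%N]addnC addn0 addn2 /sum_formula_coeff subn1 /= addn1.
  set z := zF L; set c := 'C(_, a)%:R; set c' := 'C(_, b)%:R; set x := mzv R _ => h.
  (* The signs of c' disagree exactly when k = a + b + 2 is even, and then zeta(k) is in the
     ideal. *)
  have -> : z - (-1) ^+ a * (c + (-1) ^+ (a + b).+1 * c') * x =
     z - (-1) ^+ a * (c * x + c' * x) + (-1) ^+ a * c' * ((1 + (-1) ^+ (a + b).+2) * x).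
    rewrite !exprS; ring.
  apply: zeta2_idealD => //; apply: zeta2_idealMl.
    by apply: mzv_spaceM; [exact: mzv_space_sign|have := mzv_space_int R 'C((a +
      b).+1, b)].
  by rewrite -[x]zeta_star_mzv //; exact: zeta2_ideal_parity.
set k := (a + b + 2 + d.+1)%N; apply: (@zeta2_ideal_cancel d).
have ka : (a.+1 + b + 2 + d = k)%N by rewrite /k; lia.
have kb : (a + b.+1 + 2 + d = k)%N by rewrite /k; lia.
have ia := IH a.+1 b; have ib := IH a b.+1; rewrite ka in ia; rewrite kb in ib.
have := zeta2_ideal_relation k (positive_ones_two a b).
rewrite sum_ins1 sumn_cat [sumn (_ :: _)]/= !sumn_ones (_ : (k - _ = d.+1)%N);
  last first.
  by rewrite /k; lia.
have := @sum_formula_coeff_rec a b d; rewrite -/k.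
move: ia ib; set B := sum_formula_coeff k; set x := mzv R [:: k].
set S1 := bsum _ _ _; set S2 := bsum _ _ _; set S := bsum _ _ _ => ia ib hB h.
(* The relation for the sums minus that for the coefficients; S1 and S2, one letter longer, are
   known by induction. *)
have -> : (S - B a b * x) *+ d.+1 =
   S1 *+ a.+1 + S2 *+ b.+1 + S *+ d.+1 - (S1 - B a.+1 b * x) *+ a.+1
   - (S2 - B a b.+1 * x) *+ b.+1 -
   (B a.+1 b *+ a.+1 + B a b.+1 *+ b.+1 + B a b *+ d.+1) * x.
  ring.
rewrite hB mul0r subr0.
by apply: zeta2_idealB; [apply: zeta2_idealB => //|]; exact: zeta2_ideal_nat.
Qed.

End SymmetricMZV.

Theorem theorem1p2 (R : realType) (k n i : nat)
  (hi : (1 <= i)%N) (hin : (i <= n)%N) (hnk : (n <= k - 1)%N) :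
  zeta2_ideal
    (\sum_(t : n.-tuple 'I_k.+1 |
           [&& sumn (index_of t) == k, positive_index (index_of t)
             & (2 <= nth 0 (index_of t) (i - 1))%N])
       zeta_star_F R (index_of t)
     - (-1) ^+ (i - 1) *
       ('C(k - 1, i - 1)%:R + (-1) ^+ n * 'C(k - 1, n - i)%:R) *
       mzv R [:: k]).
Proof.
set a := (i - 1)%N; set b := (n - i)%N.
have nab : (n = a + b + 1)%N by rewrite /a /b; lia.
(* The hypothesis n <= k - 1 makes this subtraction exact. *)
have kab : (k = a + b + 2 + (k - 1 - n))%N by rewrite /a /b; lia.
pose L := nseq a 1%N ++ 2%N :: nseq b 1%N.
have sL : size L = n by rewrite size_cat /= !size_nseq; lia.
have -> : \sum_(t : n.-tuple 'I_k.+1 | [&& sumn (index_of t) == k,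
    positive_index (index_of t) & (2 <= nth 0 (index_of t) a)%N])
    zeta_star_F R (index_of t) = bsum (zeta_star_F R) k L.
  rewrite -(sum_tuple_bsum (zeta_star_F R) L (leqnn k)) sL.
  apply: eq_bigl => t; rewrite all2_leq_ones_two //.
  by rewrite size_map size_tuple; lia.
have := sum_formula_ones_two R (k - 1 - n) a b.
by rewrite -kab /sum_formula_coeff -nab.
Qed.
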